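(* Let $m\ge2$, $c>0$ and let $k\ge 0$ be fixed. Then the eigenvalues $\lambda_{n,m}^{k,c}$, $n=0,1,2,\dots$, of $QP_c$ are distinct: $\lambda_{n,m}^{k,c}\neq\lambda_{n',m}^{k,c}$ whenever $n\ne n'$.
   Context: $\mathbb{R}_m$ (resp. $\mathbb{C}_m$) is the real (resp. complex) Clifford algebra generated by $e_1,\dots,e_m$ with $e_j^2=-1$, $e_ie_j=-e_je_i$ ($i\ne j$). A point $x\in\mathbb{R}^m$ is identified with $\sum_j e_jx_j$, so $x^2=-|x|^2$; $\langle x,y\rangle=\sum_j x_jy_j$ for vectors. Clifford conjugation $\lambda\mapsto\bar\lambda$ is the conjugate-linear anti-automorphism of $\mathbb{C}_m$ with $\overline{e_j}=-e_j$. The Dirac operator is $\partial_x=\sum_j e_j\partial_{x_j}$ (acting from the left). $B(r)$ is the closed ball of radius $r$ centred at $0$ in $\mathbb{R}^m$. For $c\ge0$, $L_cf(x)=\partial_x\big((1-|x|^2)\partial_xf(x)\big)+4\pi^2c^2|x|^2f(x)$ on $B(1)$. $M_l^+(k)$ is the right $\mathbb{R}_m$-module of $\mathbb{R}_m$-valued polynomials on $\mathbb{R}^m$ that are homogeneous of degree $k$ and left monogenic ($\partial_xY=0$); it has rank $d_k=\frac{(m+k-2)!}{(m-2)!\,k!}$. Fix a basis $\{Y_k^i\}_{i=1}^{d_k}$ of it with $\int_{S^{m-1}}\overline{Y_k^i(\omega)}Y_k^j(\omega)\,d\omega=\delta_{ij}$. Clifford prolate spheroidal wave functions (CPSWFs).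 Even: the real $\chi$ for which there is a nonzero $P\in C^\infty([0,1],\mathbb{R})$ with $L_c[P(|x|^2)Y_k^i(x)]=\chi P(|x|^2)Y_k^i(x)$ on $B(1)$ do not depend on $i$ and form a strictly increasing sequence $\chi_{0,m}^{k,c}<\chi_{2,m}^{k,c}<\cdots$; for $\chi=\chi_{2N,m}^{k,c}$, $P=P_{N,m}^{k,c}$ is unique up to a real factor, and $\psi_{2N,m}^{k,c,i}(x)=P_{N,m}^{k,c}(|x|^2)Y_k^i(x)$. Odd: likewise with $xQ(|x|^2)Y_k^i(x)$ in place of $P(|x|^2)Y_k^i(x)$, giving $\chi_{1,m}^{k,c}<\chi_{3,m}^{k,c}<\cdots$, functions $Q_{N,m}^{k,c}$, and $\psi_{2N+1,m}^{k,c,i}(x)=xQ_{N,m}^{k,c}(|x|^2)Y_k^i(x)$. All are normalised in $L^2(B(1))$ and extended by $0$ outside $B(1)$. Operators: $\mathcal{F}f(\xi)=\int_{\mathbb{R}^m}e^{-2\pi i\langle x,\xi\rangle}f(x)\,dx$; $Qf=\chi_{B(1)}f$ (indicator of $B(1)$); $P_cf(x)=\int_{B(c)}\mathcal{F}f(\xi)e^{2\pi i\langle\xi,x\rangle}\,d\xi$. For each $n,k,i$ the CPSWF is an eigenfunction, $QP_c\psi_{n,m}^{k,c,i}=\lambda_{n,m}^{k,c}\psi_{n,m}^{k,c,i}$, with an eigenvalue $\lambda_{n,m}^{k,c}>0$ independent of $i$. *)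

(* Defs.v *)
From HB Require Import structures.
From mathcomp Require Import all_boot all_order all_algebra ring.
Set Implicit Arguments.
Unset Strict Implicit.
Unset Printing Implicit Defensive.
Import Order.TTheory GRing.Theory Num.Theory.
Local Open Scope ring_scope.

Section SymmetricDifference.
Variable m : nat.
Implicit Types A B C : {set 'I_m}.

Definition symdiff A B : {set 'I_m} := [set i | (i \in A) (+) (i \in B)].

Lemma symdiffA A B C : symdiff A (symdiff B C) = symdiff (symdiff A B) C.
Proof. by apply/setP => i; rewrite !inE addbA. Qed.

Lemma symdiffC A B : symdiff A B = symdiff B A.
Proof. by apply/setP => i; rewrite !inE addbC. Qed.

Lemma symdiff0 A : symdiff A set0 = A.
Proof. by apply/setP => i; rewrite !inE addbF. Qed.

Lemma symdiffv A : symdiff A A = set0.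
Proof. by apply/setP => i; rewrite !inE addbb. Qed.

Lemma symdiffK A B : symdiff A (symdiff A B) = B.
Proof. by rewrite symdiffA symdiffv symdiffC symdiff0. Qed.

(* Parity of the number of pairs (i, j) in A x B with j <= i: sorting the word
   e_A e_B takes one transposition for each pair with j < i, and each common
   index i = j contributes e_i ^+ 2 = -1. *)
Definition clsign A B : bool :=
  \big[addb/false]_i \big[addb/false]_j [&& i \in A, j \in B & j <= i]%N.

Lemma clsignDl A B C : clsign (symdiff A B) C = clsign A C (+) clsign B C.
Proof.
rewrite /clsign -big_split; apply: eq_bigr => i _ /=.
rewrite -big_split; apply: eq_bigr => j _ /=.
by rewrite !inE; case: (i \in A); case: (i \in B); case: (j \in C); case: (_ <= _)%N.
Qed.

Lemma clsignDr A B C : clsign A (symdiff B C) = clsign A B (+) clsign A C.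
Proof.
rewrite /clsign -big_split; apply: eq_bigr => i _ /=.
rewrite -big_split; apply: eq_bigr => j _ /=.
by rewrite !inE; case: (i \in A); case: (j \in B); case: (j \in C); case: (_ <= _)%N.
Qed.

Lemma clsign0l A : clsign set0 A = false.
Proof. by apply: big1 => i _; apply: big1 => j _; rewrite inE. Qed.

Lemma clsign0r A : clsign A set0 = false.
Proof.
by apply: big1 => i _; apply: big1 => j _; rewrite inE andbF.
Qed.

Lemma clsign1 i j : clsign [set i] [set j] = (j <= i)%N.
Proof.
rewrite /clsign (bigD1 i) //= [X in _ (+) X]big1 ?addbF => [|a ai]; last first.
  by apply: big1 => b _; rewrite inE (negbTE ai).
rewrite (bigD1 j) //= [X in _ (+) X]big1 ?addbF => [|b bj]; first by rewrite !set11.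
by rewrite !inE (negbTE bj) andbF.
Qed.

End SymmetricDifference.

(* An element a of the Clifford algebra over K with generators e_j, j < m, is
   the family of its coordinates a A on the basis e_A, where A ranges over the
   sets of indices and e_A is the product of the e_j, j in A, in increasing
   order.  The product is given by e_A e_B = (-1) ^ (clsign A B) e_(A D B). *)
Definition clifford (K : Type) (m : nat) := {ffun {set 'I_m} -> K}.

HB.instance Definition _ (K : nzRingType) m :=
  GRing.Lmodule.copy (clifford K m) {ffun {set 'I_m} -> K^o}.

Section CliffordAlgebra.
Variables (K : comNzRingType) (m : nat).
Implicit Types (a b c : clifford K m) (A B C : {set 'I_m}).

Definition clblade A : clifford K m := [ffun B => (B == A)%:R].

Definition clmul a b : clifford K m :=
  [ffun C => \sum_A (-1) ^+ clsign A (symdiff A C) * a A * b (symdiff A C)].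

Lemma clmulA : associative clmul.
Proof.
move=> a b c; apply/ffunP => D; rewrite !ffunE.
under [RHS]eq_bigr => C _ do rewrite ffunE mulr_sumr mulr_suml.
rewrite exchange_big /=; apply: eq_bigr => A _; rewrite ffunE mulr_sumr.
have inj : injective (symdiff A) by apply: can_inj (symdiffK A).
rewrite [RHS](reindex_inj inj) /=; apply: eq_bigr => B _.
have -> : symdiff (symdiff A B) D = symdiff B (symdiff A D).
  by rewrite (symdiffC A) symdiffA.
rewrite !symdiffK; set C := symdiff B (symdiff A D).
have -> : symdiff A D = symdiff B C by rewrite /C symdiffK.
rewrite clsignDl clsignDr !signr_addb.
by ring.
Qed.

Lemma clmul1l : left_id (clblade set0) clmul.
Proof.
move=> a; apply/ffunP => C; rewrite ffunE (bigD1 set0) //= big1 ?addr0.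
  by rewrite ffunE eqxx clsign0l symdiffC symdiff0 !mul1r.
by move=> A /negbTE A0; rewrite ffunE A0 mulr0 mul0r.
Qed.

Lemma clmul1r : right_id (clblade set0) clmul.
Proof.
move=> a; apply/ffunP => C; rewrite ffunE (bigD1 C) //= big1 ?addr0.
  by rewrite symdiffv ffunE eqxx clsign0r mul1r mulr1.
move=> A nAC; rewrite ffunE; case: eqP => [nAC0|]; last by rewrite mulr0.
by move/eqP: nAC; case; rewrite -(symdiffK A C) nAC0 symdiff0.
Qed.

Lemma clmulDl : left_distributive clmul +%R.
Proof.
move=> a b c; apply/ffunP => C; rewrite !ffunE -big_split; apply: eq_bigr => A _.
by rewrite !ffunE mulrDr mulrDl.
Qed.

Lemma clmulDr : right_distributive clmul +%R.
Proof.
move=> a b c; apply/ffunP => C; rewrite !ffunE -big_split; apply: eq_bigr => A _.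
by rewrite !ffunE mulrDr.
Qed.

Lemma cl1_neq0 : clblade set0 != 0.
Proof. by apply/eqP => /ffunP/(_ set0); rewrite !ffunE eqxx => /eqP; rewrite oner_eq0. Qed.

HB.instance Definition _ := GRing.Zmodule_isNzRing.Build (clifford K m)
  clmulA clmul1l clmul1r clmulDl clmulDr cl1_neq0.

Lemma clscaleAl (x : K) a b : x *: (a * b) = (x *: a) * b.
Proof.
apply/ffunP => C; rewrite !ffunE scaler_sumr; apply: eq_bigr => A _.
by rewrite !ffunE /GRing.scale /= !mulrA [x * _]mulrC.
Qed.

HB.instance Definition _ :=
  GRing.Lmodule_isLalgebra.Build K (clifford K m) clscaleAl.

Lemma clscaleAr (x : K) a b : x *: (a * b) = a * (x *: b).
Proof.
apply/ffunP => C; rewrite !ffunE scaler_sumr; apply: eq_bigr => A _.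
by rewrite !ffunE /GRing.scale /= mulrCA.
Qed.

HB.instance Definition _ :=
  GRing.Lalgebra_isAlgebra.Build K (clifford K m) clscaleAr.

Lemma clmulE a b C :
  (a * b) C = \sum_A (-1) ^+ clsign A (symdiff A C) * a A * b (symdiff A C).
Proof. exact: ffunE. Qed.

Lemma clblade0 : clblade set0 = 1.
Proof. by []. Qed.

Lemma clbladeM A B :
  clblade A * clblade B = (-1) ^+ clsign A B *: clblade (symdiff A B).
Proof.
apply/ffunP => C; rewrite clmulE (bigD1 A) //= big1 ?addr0.
  rewrite !ffunE eqxx mulr1 /GRing.scale /=.
  case: (altP (symdiff A C =P B)) => [<-|]; first by rewrite symdiffK eqxx.
  case: (altP (C =P symdiff A B)) => [->|]; last by rewrite !mulr0.
  by rewrite symdiffK eqxx.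
by move=> A' /negbTE A'A; rewrite ffunE A'A mulr0 mul0r.
Qed.

Lemma clifford_sum_blade a : a = \sum_A a A *: clblade A.
Proof.
apply/ffunP => C; rewrite sum_ffunE (bigD1 C) //= big1 ?addr0.
  by rewrite !ffunE eqxx /GRing.scale /= mulr1.
by move=> A nAC; rewrite !ffunE eq_sym (negbTE nAC) /GRing.scale /= mulr0.
Qed.

Definition clgen (j : 'I_m) : clifford K m := clblade [set j].

Lemma clgen_sqr j : clgen j * clgen j = - 1.
Proof. by rewrite clbladeM clsign1 leqnn symdiffv clblade0 scaleN1r. Qed.

Lemma clgen_anti i j : i != j -> clgen i * clgen j = - (clgen j * clgen i).
Proof.
move=> ij; rewrite !clbladeM symdiffC !clsign1.
have -> : (i <= j)%N = ~~ (j <= i)%N.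
  by rewrite -ltnNge ltn_neqAle ij.
by case: (j <= i)%N; rewrite ?scaleN1r ?scale1r ?opprK.
Qed.

(* The linear anti-automorphism with e_j |-> - e_j: it maps e_A to e_A ^-1. *)
Definition clconj a : clifford K m := [ffun A => (-1) ^+ clsign A A * a A].

Lemma clconj_gen j : clconj (clgen j) = - clgen j.
Proof.
apply/ffunP => A; rewrite !ffunE.
case: eqP => [->|]; last by rewrite mulr0 oppr0.
by rewrite clsign1 leqnn mulN1r.
Qed.

Lemma clconjM a b : clconj (a * b) = clconj b * clconj a.
Proof.
apply/ffunP => C; rewrite ffunE !clmulE mulr_sumr.
have inj : injective (fun A => symdiff A C).
  by move=> A B /(congr1 (symdiff C)); rewrite !(symdiffC _ C) !symdiffK.
rewrite [RHS](reindex_inj inj) /=; apply: eq_bigr => A _.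
have e : symdiff (symdiff A C) C = A by rewrite -symdiffA symdiffv symdiff0.
rewrite e !ffunE; set B := symdiff A C.
have := symdiffK A C; rewrite -/B; clearbody B => <-.
rewrite clsignDl !clsignDr !signr_addb.
have sq : (-1) ^+ clsign A B * (-1) ^+ clsign A B = 1 :> K.
  by rewrite -signr_addb addbb.
transitivity ((-1) ^+ clsign A B * (-1) ^+ clsign A B
   * ((-1) ^+ clsign B A * ((-1) ^+ clsign B B * b B)
      * ((-1) ^+ clsign A A * a A))); last by rewrite sq mul1r.
by ring.
Qed.
End CliffordAlgebra.

From mathcomp Require Import all_classical all_reals all_analysis complex.
Import numFieldNormedType.Exports.
Local Open Scope classical_set_scope.
Local Open Scope ring_scope.

Section LebesgueMeasureTuple.
Variable R : realType.
Local Notation rtuple n := (n.-tuple (measurableTypeR R)).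

Section ConsMeasure.
Variables (n : nat) (mu : {sigma_finite_measure set (rtuple n) -> \bar R}).
Local Open Scope ereal_scope.

Definition tcons (p : measurableTypeR R * rtuple n) : rtuple n.+1 :=
  [tuple of p.1 :: p.2].

Lemma measurable_tcons : measurable_fun setT tcons.
Proof. by apply: measurable_cons; [exact: measurable_fst|exact: measurable_snd]. Qed.

Definition cons_measure : set (rtuple n.+1) -> \bar R :=
  pushforward (lebesgue_measure \x mu) tcons.

Let cons_measure0 : cons_measure set0 = 0.
Proof. by rewrite /cons_measure /pushforward preimage_set0 measure0. Qed.

Let cons_measure_ge0 A : 0 <= cons_measure A.
Proof. by rewrite /cons_measure /pushforward measure_ge0. Qed.

Let cons_measure_sigma_additive : semi_sigma_additive cons_measure.
Proof.
move=> F mF tF mUF; rewrite /cons_measure /pushforward preimage_bigcup.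
apply: measure_semi_sigma_additive.
- by move=> i; rewrite -[X in measurable X]setTI; exact: measurable_tcons.
- apply/trivIsetP => /= i j _ _ ij; rewrite -preimage_setI.
  by move/trivIsetP : tF => /(_ _ _ _ _ ij) ->//; rewrite preimage_set0.
- by rewrite -preimage_bigcup -[X in measurable X]setTI; exact: measurable_tcons.
Qed.

HB.instance Definition _ := isMeasure.Build _ _ _ cons_measure
  cons_measure0 cons_measure_ge0 cons_measure_sigma_additive.

Lemma cons_measureX (A : set (measurableTypeR R)) (B : set (rtuple n)) :
  measurable A -> measurable B ->
  cons_measure [set t | A (thead t) /\ B [tuple of behead t]] =
  lebesgue_measure A * mu B.
Proof.
move=> mA mB; rewrite /cons_measure /pushforward -product_measure1E //.
rewrite (_ : tcons @^-1` _ = A `*` B) //.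
have bK x (t : rtuple n) : [tuple of behead (tcons (x, t))] = t by exact: val_inj.
by apply/seteqP; split => -[x t] /=; rewrite theadE bK.
Qed.

Lemma measurable_consX (A : set (measurableTypeR R)) (B : set (rtuple n)) :
  measurable A -> measurable B ->
  measurable [set t : rtuple n.+1 | A (thead t) /\ B [tuple of behead t]].
Proof.
move=> mA mB.
rewrite [X in measurable X](_ : _ =
  (fun t : rtuple n.+1 => tnth t ord0) @^-1` A `&`
  (fun t : rtuple n.+1 => [tuple of behead t]) @^-1` B).
  apply: measurableI; rewrite -[X in measurable X]setTI.
    exact: measurable_tnth.
  exact: measurable_behead.
by apply/seteqP; split.
Qed.

Let cons_measure_sigma_finite : sigma_finite setT cons_measure.
Proof.
have /sigma_finiteP[F [TF ndF Foo]] :=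
  sigma_finiteT (@lebesgue_measure R : {sigma_finite_measure set _ -> \bar R}).
have /sigma_finiteP[G [TG ndG Goo]] := sigma_finiteT mu.
exists (fun i => [set t : rtuple n.+1 | F i (thead t) /\ G i [tuple of behead t]]).
  apply/seteqP; split => // t _.
  have [i _ Fi] : (\bigcup_i F i) (thead t) by rewrite -TF.
  have [j _ Gj] : (\bigcup_i G i) [tuple of behead t] by rewrite -TG.
  exists (maxn i j) => //; split.
  - by move: Fi; exact/subsetPset/ndF/leq_maxl.
  - by move: Gj; exact/subsetPset/ndG/leq_maxr.
move=> i; have [mF Ff] := Foo i; have [mG Gf] := Goo i.
split; first exact: measurable_consX.
by rewrite cons_measureX // lte_mul_pinfty // ge0_fin_numE.
Qed.

HB.instance Definition _ := Measure_isSigmaFinite.Build _ _ _ cons_measure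
  cons_measure_sigma_finite.

End ConsMeasure.

(* Lebesgue measure on R^n, as the n-fold product of the one-dimensional one. *)
Fixpoint tuple_lebesgue n : {sigma_finite_measure set (rtuple n) -> \bar R} :=
  if n is n'.+1 then cons_measure (tuple_lebesgue n')
  else \d_([tuple] : rtuple 0).

Definition tuple_box n (a b : 'I_n -> R) : set (rtuple n) :=
  [set t | forall i, tnth t i \in `[a i, b i]].

Lemma tuple_box_cons n (a b : 'I_n.+1 -> R) :
  tuple_box a b = [set t | `[a ord0, b ord0]%classic (thead t) /\
    tuple_box (a \o lift ord0) (b \o lift ord0) [tuple of behead t]].
Proof.
apply/seteqP; split => t /= => [tab|[t0 tS] i].
  split; first exact: tab.
  by move=> i; have := tab (lift ord0 i); rewrite [in tnth t _](tuple_eta t) tnthS.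
case: (unliftP ord0 i) => [j ->|->]; last exact: t0.
by have := tS j; rewrite [in tnth t _](tuple_eta t) tnthS.
Qed.

Lemma measurable_tuple_box n (a b : 'I_n -> R) : measurable (tuple_box a b).
Proof.
elim: n => [|n IHn] in a b *.
  rewrite (_ : tuple_box a b = setT); first exact: measurableT.
  by apply/seteqP; split => // t _ [].
by rewrite tuple_box_cons; apply: measurable_consX => //; exact: measurable_itv.
Qed.

Lemma tuple_lebesgue_box n (a b : 'I_n -> R) : (forall i, a i <= b i) ->
  tuple_lebesgue n (tuple_box a b) = (\prod_i (b i - a i))%:E.
Proof.
elim: n => [|n IHn] in a b * => ab.
  by rewrite big_ord0 /= diracE mem_set // => -[].
rewrite tuple_box_cons.
transitivity (lebesgue_measure `[a ord0, b ord0]%classic *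
  tuple_lebesgue n (tuple_box (a \o lift ord0) (b \o lift ord0)))%E.
  by apply: cons_measureX; [exact: measurable_itv|exact: measurable_tuple_box].
rewrite IHn => [|i]; last exact: ab.
rewrite big_ord_recl EFinM lebesgue_measure_itv /= lte_fin; congr (_ * _)%E.
by case: ltgtP (ab ord0) => // ->; rewrite subrr.
Qed.
End LebesgueMeasureTuple.

Section EuclideanSpace.
Variables (R : realType) (m : nat).
Implicit Types (x y : 'rV[R]_m) (D : set 'rV[R]_m).

Definition dot x y : R := \sum_j x 0 j * y 0 j.

(* The norm `|x| of the library on 'rV[R]_m is the sup norm. *)
Definition enorm x : R := Num.sqrt (dot x x).

Definition cball (r : R) : set 'rV[R]_m := [set x | enorm x <= r].

Definition row_of_tuple (t : m.-tuple (measurableTypeR R)) : 'rV[R]_m :=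
  \row_j tnth t j.

(* Row vectors carry no measurable structure in the library, so Lebesgue
   integration on R^m goes through the measurable type of m-tuples. *)
Definition eint D (f : 'rV[R]_m -> R) : R :=
  \int[tuple_lebesgue R m]_(t in row_of_tuple @^-1` D) f (row_of_tuple t).

Definition ceint D (f : 'rV[R]_m -> R[i]) : R[i] :=
  (eint D (fun x => complex.Re (f x)) +i* eint D (fun x => complex.Im (f x)))%C.

Definition expi (theta : R) : R[i] := (cos theta +i* sin theta)%C.

(* Integral for the surface measure of the unit sphere, whose value on A is
   m times the Lebesgue measure of the cone {x | 0 < |x| <= 1, x / |x| in A}. *)
Definition sphere_int (g : 'rV[R]_m -> R) : R :=
  m%:R * eint (cball 1 `\ 0) (fun x => g ((enorm x)^-1 *: x)).

(* Truncation to the closed unit ball: the operator usually written Q. *)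
Definition trunc (V : zmodType) (f : 'rV[R]_m -> V) x : V :=
  if enorm x <= 1 then f x else 0.

End EuclideanSpace.

Section DiracOperator.
Variables (R : realType) (m : nat).
Implicit Types (f : 'rV[R]_m -> clifford R m) (x y : 'rV[R]_m).

Definition clvec x : clifford R m := \sum_j x 0 j *: clgen R j.

Definition partial (j : 'I_m) f x : clifford R m :=
  [ffun A => 'D_(delta_mx 0 j) (fun y => f y A : R) x : R].

Definition dirac f x : clifford R m := \sum_j clgen R j * partial j f x.

(* The square of the Clifford norm, i.e. the scalar part of clconj a * a. *)
Definition clsqnorm (a : clifford R m) : R := \sum_A a A ^+ 2.

Lemma clsqnormE (a : clifford R m) : clsqnorm a = (clconj a * a) finset.set0.
Proof.
rewrite clmulE; apply: eq_bigr => A _.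
by rewrite symdiff0 ffunE mulrA -signr_addb addbb mul1r expr2.
Qed.

(* Homogeneous polynomial functions of degree k with Clifford coefficients,
   written on the monomials x ^ al with al : 'I_m -> {0, .., k}, |al| = k. *)
Definition homogeneous_poly (k : nat) f : Prop :=
  exists a : {ffun 'I_m -> 'I_k.+1} -> clifford R m, forall x,
    f x = \sum_(al : {ffun 'I_m -> 'I_k.+1} | (\sum_j al j == k)%N)
            (\prod_j x 0 j ^+ al j) *: a al.

Definition monogenic (k : nat) f : Prop :=
  homogeneous_poly k f /\ forall x, dirac f x = 0.

Definition dim_monogenic (k : nat) : nat :=
  ((m + k - 2)`! %/ ((m - 2)`! * k`!))%N.

Record monogenic_onb (k : nat)
    (Y : 'I_(dim_monogenic k) -> 'rV[R]_m -> clifford R m) : Prop := {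
  onb_monogenic : forall i, monogenic k (Y i);
  onb_basis : forall f, monogenic k f ->
    exists! a : {ffun 'I_(dim_monogenic k) -> clifford R m},
      forall x, f x = \sum_i Y i x * a i;
  onb_orthonormal : forall i j,
    [ffun A => sphere_int (fun w => (clconj (Y i w) * Y j w) A)] =
    (i == j)%:R :> clifford R m }.

End DiracOperator.

Section FourierTransform.
Variables (R : realType) (m : nat).
Implicit Types (f : 'rV[R]_m -> clifford R[i] m) (x xi : 'rV[R]_m).

Definition clint (D : set 'rV[R]_m) f : clifford R[i] m :=
  [ffun A => ceint D (fun x => f x A)].

Definition fourier f xi : clifford R[i] m :=
  clint setT (fun x => expi (- (2 * pi * dot x xi)) *: f x).

(* The operator usually written P_c. *)
Definition bandlimit (c : R) f x : clifford R[i] m :=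
  clint (cball c) (fun xi => expi (2 * pi * dot xi x) *: fourier f xi).

Definition clcomplex (a : clifford R m) : clifford R[i] m :=
  [ffun A => (a A)%:C%C].

End FourierTransform.

Section ProlateSpheroidal.
Variables (R : realType) (m : nat).
Implicit Types (f Y : 'rV[R]_m -> clifford R m) (P Q : R -> R).

Definition prolate_op (c : R) f x : clifford R m :=
  dirac (fun y => (1 - enorm y ^+ 2) *: dirac f y) x
  + (4 * pi ^+ 2 * c ^+ 2 * enorm x ^+ 2) *: f x.

Definition even_mode Y P x : clifford R m := P (enorm x ^+ 2) *: Y x.

Definition odd_mode Y Q x : clifford R m :=
  Q (enorm x ^+ 2) *: (clvec x * Y x).

Definition smooth P : Prop := forall n t, derivable (derive1n n P) t 1.

(* C^oo([0, 1]) is represented by smooth functions on R, of which only the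
   restriction to [0, 1] matters; thus all derivatives below are ordinary ones,
   also at the boundary points of the ball. *)
Definition eigenprofile (c : R) (mode : (R -> R) -> 'rV[R]_m -> clifford R m)
    (mu : R) P : Prop :=
  [/\ smooth P, exists2 t, 0 <= t <= 1 & P t != 0 &
      forall x, cball 1 x -> prolate_op c (mode P) x = mu *: mode P x].

Definition cpswf Y (P Q : nat -> R -> R) (n : nat) : 'rV[R]_m -> clifford R m :=
  trunc (if odd n then odd_mode Y (Q n./2) else even_mode Y (P n./2)).

Record cpswf_family (k : nat) (c : R)
    (Y : 'I_(dim_monogenic m k) -> 'rV[R]_m -> clifford R m)
    (chi : nat -> R) (P Q : nat -> R -> R) : Prop := {
  even_spectrum : forall i mu,
    (exists N, chi N.*2 = mu) <->
    (exists p, eigenprofile c (even_mode (Y i)) mu p);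
  odd_spectrum : forall i mu,
    (exists N, chi N.*2.+1 = mu) <->
    (exists q, eigenprofile c (odd_mode (Y i)) mu q);
  even_increasing : forall N N', (N < N')%N -> chi N.*2 < chi N'.*2;
  odd_increasing : forall N N', (N < N')%N -> chi N.*2.+1 < chi N'.*2.+1;
  even_profile : forall i N,
    eigenprofile c (even_mode (Y i)) (chi N.*2) (P N);
  odd_profile : forall i N,
    eigenprofile c (odd_mode (Y i)) (chi N.*2.+1) (Q N);
  cpswf_normalised : forall i n,
    eint (cball 1) (fun x => clsqnorm (cpswf (Y i) P Q n x)) = 1 }.

End ProlateSpheroidal.

(* Main.v *)
Require Import Defs.
From mathcomp Require Import all_boot all_order all_algebra.
From mathcomp Require Import all_classical all_reals all_analysis.
From mathcomp Require Import complex.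
From mathcomp Require Import measurable_realfun ring lra zify.
Import Order.TTheory GRing.Theory Num.Theory numFieldNormedType.Exports.
Local Open Scope classical_set_scope.
Local Open Scope ring_scope.
Set Implicit Arguments.
Unset Strict Implicit.
Unset Printing Implicit Defensive.

(* On the unit ball an eigenfunction psi of Q P_c with eigenvalue lambda is
   lambda^-1 times the superposition over the ball of radius c of the waves
   cos (2 pi <xi, x>) and sin (2 pi <xi, x>), weighted by the cosine and sine
   transforms of psi.  The Dirac operator acts on such superpositions by left
   multiplication by 2 pi xi, so Fubini's theorem shows that two eigenfunctions
   f, g with the same eigenvalue satisfy
     <D f, g> = <f, D g>  and  <D D f, g> = <f, D D g>
   for the scalar product <f, g> of L^2 (B(1)).  For CPSWFs both identities are
   purely radial: with t = |x|^2 and s = m + 2 k one has D (P Y) = 2 P' x Y and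
   D (x Q Y) = - (2 t Q' + s Q) Y, while the divergence theorem for the field
   x G(|x|^2) |Y|^2 gives
     int_B (2 t G' + s G) |Y|^2 = s G(1) int_B |Y|^2.
   The first identity, for G = P Q, yields P(1) Q(1) = 0 when the parities
   differ; the second one yields a vanishing Wronskian at t = 1 when they agree.
   The radial equation is singular at t = 1: there it expresses P'(1) through
   chi and P(1), and it forces P = 0 if P(1) = 0.  Hence P(1) Q(1) = 0 is
   absurd, and a vanishing Wronskian means that both functions have the same
   chi, that is the same index. *)

(* The library also calls dirac the Dirac measure at a point. *)
Local Notation dirac := Defs.dirac.

(** * Bounded measurable functions *)

(** Why two identities are needed: D exchanges even and odd modes, and an even and an odd mode built
    on the same Y are pointwise orthogonal, because left multiplication by x is skew for the scalar
    product. So the identity for D is 0 = 0 when the parities agree, and the one for D D is 0 = 0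
    when they differ. For arbitrary smooth f and g the defects of both identities are boundary terms
    on the unit sphere. They vanish here because f and g are superpositions of waves with the same
    factor lambda^-1; this common factor is all that the equality of the eigenvalues provides. The
    obstacle is the sphere, across which the truncated functions jump. The wave representation is
    smooth on all of R^m and is compared with f on the open ball only, the sphere being a null set.
    The boundary value G(1) is reached without surface integrals, by differentiating in r, at r = 1,
    the integral over the ball of radius r. All of this is done over the reals: Y and the profiles
    are real, and the real part of the eigenvalue equation is enough. *)

Section BoundedMeasurable.
Context d (T : measurableType d) (R : realType).
Implicit Types (D : set T) (f g : T -> R).

(** All integrals below run over sets of finite measure. On those this class is closed under sums
    and products and consists of integrable functions, so one predicate serves Fubini's theorem and
    every linearity step. *)
Definition bmeas D f :=
  measurable_fun D f /\ exists M : R, forall x, D x -> `|f x| <= M.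

Lemma bmeas_cst D (r : R) : bmeas D (cst r).
Proof. by split; [exact: measurable_cst|exists `|r|]. Qed.

Lemma bmeasD D f g : bmeas D f -> bmeas D g -> bmeas D (fun x => f x + g x).
Proof.
move=> [mf [M fM]] [mg [N gN]]; split; first exact: measurable_funD.
exists (M + N) => x Dx; rewrite (le_trans (ler_normD _ _))// lerD ?fM ?gN //.
Qed.

Lemma bmeasM D f g : bmeas D f -> bmeas D g -> bmeas D (fun x => f x * g x).
Proof.
move=> [mf [M fM]] [mg [N gN]]; split; first exact: measurable_funM.
by exists (M * N) => x Dx; rewrite normrM ler_pM ?fM ?gN.
Qed.

Lemma bmeasZ D (r : R) f : bmeas D f -> bmeas D (fun x => r * f x).
Proof. exact/bmeasM/bmeas_cst. Qed.

Lemma bmeas_sum D (I : Type) (s : seq I) (P : pred I) (F : I -> T -> R) :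
  (forall i, bmeas D (F i)) -> bmeas D (fun x => \sum_(i <- s | P i) F i x).
Proof.
move=> bF; elim: s => [|i s IHs].
  under [X in bmeas _ X]eq_fun do rewrite big_nil; exact: bmeas_cst.
under [X in bmeas _ X]eq_fun do rewrite big_cons.
by case: (P i) => //; apply: bmeasD.
Qed.

Lemma bmeas_eq D f g : {in D, f =1 g} -> bmeas D f -> bmeas D g.
Proof.
move=> fg [mf [M fM]]; split; first exact: eq_measurable_fun mf.
by exists M => x Dx; rewrite -fg ?inE // fM.
Qed.

Variables (mu : {measure set T -> \bar R}) (D : set T).
Hypotheses (mD : measurable D) (muD : (mu D < +oo)%E).

Lemma bmeas_integrable f : bmeas D f -> mu.-integrable D (EFin \o f).
Proof.
move=> [mf [M fM]]; apply: measurable_bounded_integrable => //.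
exists M; split; first exact: num_real.
by move=> N MN x Dx /=; rewrite (le_trans (fM _ Dx)) // ltW.
Qed.

Lemma Rintegral_sum (I : Type) (s : seq I) (P : pred I) (F : I -> T -> R) :
  (forall i, bmeas D (F i)) ->
  \int[mu]_(x in D) (\sum_(i <- s | P i) F i x) =
  \sum_(i <- s | P i) \int[mu]_(x in D) F i x.
Proof.
move=> bF; elim: s => [|i s IHs].
  rewrite big_nil; under eq_Rintegral do rewrite big_nil.
  by rewrite Rintegral_cst // mul0r.
rewrite big_cons; under eq_Rintegral do rewrite big_cons.
case: (P i); rewrite -IHs // RintegralD //; apply: bmeas_integrable => //.
exact: bmeas_sum.
Qed.

Lemma Rintegral_le_bound f (M : R) : measurable_fun D f ->
  (forall x, D x -> `|f x| <= M) ->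
  `|\int[mu]_(x in D) f x| <= M * fine (mu D).
Proof.
move=> mf fM; have bf : bmeas D f by split => //; exists M.
have bnf : bmeas D (fun x => `|f x|).
  split; first by apply: measurableT_comp => //; exact: normr_measurable.
  by exists M => x Dx; rewrite normr_id fM.
apply: le_trans; first by apply: le_normr_Rintegral => //; exact: bmeas_integrable.
rewrite -Rintegral_cst //; apply: le_Rintegral => //.
  exact: bmeas_integrable.
exact/bmeas_integrable/bmeas_cst.
Qed.

End BoundedMeasurable.

Section BoundedFubini.
Context d1 d2 (T1 : measurableType d1) (T2 : measurableType d2) (R : realType).
Variables (m1 : {sigma_finite_measure set T1 -> \bar R}).
Variables (m2 : {sigma_finite_measure set T2 -> \bar R}).
Variables (D1 : set T1) (D2 : set T2).
Hypotheses (mD1 : measurable D1) (mD2 : measurable D2).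
Hypotheses (fD1 : (m1 D1 < +oo)%E) (fD2 : (m2 D2 < +oo)%E).
Variable F : T1 * T2 -> R.
Hypothesis bF : bmeas (D1 `*` D2) F.

(** Fubini's theorem is applied on the whole product space, to the extension of [F] by zero; [G1]
    and [G2] identify its partial integrals with the truncated ones. *)
Let G := EFin \o (F \_ (D1 `*` D2)).

Let iG : (m1 \x m2)%E.-integrable setT G.
Proof.
have -> : G = (EFin \o F) \_ (D1 `*` D2) by rewrite restrict_EFin.
have mDD : measurable (D1 `*` D2) by exact: measurableX.
apply: (integrable_mkcond (mu := (m1 \x m2)%E) (EFin \o F) mDD).1;
  apply: bmeas_integrable => //.
rewrite -[X in (X < _)%E]/((m1 \x m2)%E (D1 `*` D2)) product_measure1E //.
by rewrite lte_mul_pinfty // ge0_fin_numE.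
Qed.

Let sec1 x : D1 x -> bmeas D2 (fun y => F (x, y)).
Proof.
move=> Dx; case: bF => mF [M FM]; split; last first.
  by exists M => y Dy; apply: FM.
apply: (@measurable_comp _ _ _ _ _ _ (D1 `*` D2) F) => //.
- by apply: measurableX.
- by move=> _ [y Dy <-].
- by apply: measurable_funTS; apply: measurable_fun_pair.
Qed.

Let sec2 y : D2 y -> bmeas D1 (fun x => F (x, y)).
Proof.
move=> Dx; case: bF => mF [M FM]; split; last first.
  by exists M => x Dy; apply: FM.
apply: (@measurable_comp _ _ _ _ _ _ (D1 `*` D2) F) => //.
- by apply: measurableX.
- by move=> _ [x Dy <-].
- by apply: measurable_funTS; apply: measurable_fun_pair.
Qed.

Let fin1 x : D1 x -> (\int[m2]_(y in D2) (F (x, y))%:E)%E \is a fin_num.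
Proof.
by move=> Dx; apply: integrable_fin_num => //; apply: bmeas_integrable => //; exact: sec1.
Qed.

Let fin2 y : D2 y -> (\int[m1]_(x in D1) (F (x, y))%:E)%E \is a fin_num.
Proof.
by move=> Dx; apply: integrable_fin_num => //; apply: bmeas_integrable => //; exact: sec2.
Qed.

Let G1 x : (\int[m2]_y G (x, y))%E =
  (EFin \o ((fun x => \int[m2]_(y in D2) F (x, y)) \_ D1)) x.
Proof.
rewrite /G /= [in RHS]patchE; case: ifPn => xD1; last first.
  apply: integral0_eq => y _ /=; rewrite patchE ifF //; apply: contraNF xD1.
  by rewrite !inE => -[].
rewrite /Rintegral fineK; last exact/fin1/set_mem.
rewrite [RHS]integral_mkcond; apply: eq_integral => y _.
rewrite !patchE; have -> : ((x, y) \in D1 `*` D2) = (y \in D2).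
  by apply/idP/idP => [/set_mem[]|/set_mem] ?; apply/mem_set => //; split => //;
    exact: set_mem.
by case: ifP.
Qed.

Let G2 y : (\int[m1]_x G (x, y))%E =
  (EFin \o ((fun y => \int[m1]_(x in D1) F (x, y)) \_ D2)) y.
Proof.
rewrite /G /= [in RHS]patchE; case: ifPn => yD2; last first.
  apply: integral0_eq => x _ /=; rewrite patchE ifF //; apply: contraNF yD2.
  by rewrite !inE => -[].
rewrite /Rintegral fineK; last exact/fin2/set_mem.
rewrite [RHS]integral_mkcond; apply: eq_integral => x _.
rewrite !patchE; have -> : ((x, y) \in D1 `*` D2) = (x \in D1).
  by apply/idP/idP => [/set_mem[]|/set_mem] ?; [move=> ?|]; apply/mem_set => //;
    split => //; exact: set_mem.
by case: ifP.
Qed.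

(** Keeps the class [bmeas] stable under partial integration; this is how the wave superpositions
    and the cosine and sine transforms are seen to be measurable and bounded. *)
Lemma bmeas_Rintegral : bmeas D1 (fun x => \int[m2]_(y in D2) F (x, y)).
Proof.
split.
  have := measurable_fubini_F iG; rewrite /fubini_F.
  under eq_fun do rewrite G1.
  by move=> /measurable_EFinP/(measurable_restrictT _ mD1).2.
have [M FM] := bF.2; exists (M * fine (m2 D2)) => x Dx.
apply: Rintegral_le_bound => //; first by have [] := sec1 Dx.
by move=> y Dy; apply: FM.
Qed.

Lemma Rintegral_swap :
  \int[m1]_(x in D1) (\int[m2]_(y in D2) F (x, y)) =
  \int[m2]_(y in D2) (\int[m1]_(x in D1) F (x, y)).
Proof.
have /(congr1 fine) := Fubini iG.
under [X in fine X = _]eq_integral do rewrite G1.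
under [X in _ = fine X]eq_integral do rewrite G2.
by move=> e; rewrite [LHS]Rintegral_mkcond [RHS]Rintegral_mkcond; exact: e.
Qed.

End BoundedFubini.

(** * Lebesgue measure on tuples *)

Section ScaledPushforward.
Context d1 d2 (X : measurableType d1) (Y : measurableType d2) (R : realType).
Variables (k : {nonneg R}) (mu : {measure set X -> \bar R}) (phi : X -> Y).
Hypothesis mphi : measurable_fun setT phi.

Definition scaled_pushforward : {measure set Y -> \bar R} :=
  mscale k (measure_function_pushforward__canonical__measure_function_Measure mu mphi).

Lemma scaled_pushforwardE A : scaled_pushforward A = (k%:num%:E * mu (phi @^-1` A))%E.
Proof. by []. Qed.

Lemma ge0_integral_scaled_pushforward D (f : Y -> \bar R) :
  measurable D -> measurable_fun D f -> (forall y, D y -> 0 <= f y)%E ->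
  (\int[scaled_pushforward]_(y in D) f y =
   k%:num%:E * \int[mu]_(x in phi @^-1` D) f (phi x))%E.
Proof.
move=> mD mf f0; rewrite ge0_integral_mscale //; congr (_ * _)%E.
rewrite ge0_integral_pushforward // => y /set_mem; exact: f0.
Qed.

End ScaledPushforward.

Section Scaling.
Variables (R : realType) (r : {posnum R}).
Local Notation rtuple n := (n.-tuple (measurableTypeR R)).
Local Notation leb := (@lebesgue_measure R).

Definition dilate (x : measurableTypeR R) : measurableTypeR R := r%:num * x.
Definition tdilate n (t : rtuple n) : rtuple n := [tuple of map dilate t].

Lemma measurable_dilate : measurable_fun setT dilate.
Proof. exact: mulrl_measurable. Qed.

Lemma measurable_tdilate n : measurable_fun setT (@tdilate n).
Proof.
apply/measurable_fun_tnthP => i.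
rewrite (_ : _ \o _ = dilate \o (@tnth n _)^~ i); last first.
  by apply/funext => t /=; rewrite tnth_map.
by apply: measurableT_comp; [exact: measurable_dilate|exact: measurable_tnth].
Qed.

(** Both sides are measures in [A] that agree on the intervals []a, b]], so the uniqueness of
    Lebesgue measure applies. *)
Lemma lebesgue_measure_dilate (A : set (measurableTypeR R)) : measurable A ->
  leb A = (r%:num%:E * leb (dilate @^-1` A))%E.
Proof.
move=> mA; rewrite -[RHS](scaled_pushforwardE (r%:num%:nng) leb measurable_dilate).
apply: lebesgue_measure_unique => // _ [[a b] _ <-] /=.
rewrite scaled_pushforwardE /=.
have -> : dilate @^-1` `]a, b]%classic = `]r%:num^-1 * a, r%:num^-1 * b]%classic.
  apply/seteqP; split => x /=; rewrite !in_itv /= /dilate;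
    by rewrite ltr_pdivrMl // ler_pdivlMl.
rewrite !lebesgue_measure_itv /= !lte_fin ltr_pM2l ?invr_gt0 //.
case: ifP => _; last by rewrite mule0.
by rewrite -!EFinD -EFinM -mulrBr mulrA divff ?mul1r.
Qed.

(** Induction on the dimension: a product measure is determined by its values on rectangles, and
    each coordinate contributes one factor [r]. *)
Lemma tuple_lebesgue_dilate n (A : set (rtuple n)) : measurable A ->
  tuple_lebesgue R n A =
  ((r%:num ^+ n)%:E * tuple_lebesgue R n (@tdilate n @^-1` A))%E.
Proof.
elim: n A => [|n IHn] A mA.
  rewrite expr0 mul1e /=; congr (\d_ _ _)%E.
  by apply/seteqP; split => t /=; rewrite [tdilate t]tuple0 [t]tuple0.
pose mu := tuple_lebesgue R n.
pose phi (p : measurableTypeR R * rtuple n) := (dilate p.1, tdilate p.2).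
have mphi : measurable_fun setT phi.
  apply: measurable_fun_pair; apply: measurableT_comp => //.
  - exact: measurable_dilate.
  - exact: measurable_tdilate.
have mA' : measurable (@tcons R n @^-1` A).
  by rewrite -[X in measurable X]setTI; exact: measurable_tcons.
transitivity ((leb \x mu)%E (@tcons R n @^-1` A)); first by [].
rewrite (@product_measure_unique _ _ _ _ _ leb mu
   (scaled_pushforward (r%:num ^+ n.+1)%:nng (leb \x mu)%E mphi)) //.
  rewrite scaled_pushforwardE; congr (_ * (leb \x mu)%E _)%E.
  apply/seteqP; split => -[x t] /=;
  by rewrite (_ : tcons (phi (x, t)) = tdilate (tcons (x, t))) //; exact: val_inj.
move=> B C mB mC; rewrite scaled_pushforwardE.
have -> : phi @^-1` (B `*` C) = (dilate @^-1` B) `*` (@tdilate n @^-1` C) by [].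
rewrite [X in (_ * X)%E = _]product_measure1E.
- transitivity (leb B * mu C)%E; last by [].
  by rewrite (lebesgue_measure_dilate mB) [mu C]IHn //= exprS EFinM muleACA.
- by rewrite -[X in measurable X]setTI; exact: measurable_dilate.
- by rewrite -[X in measurable X]setTI; exact: measurable_tdilate.
Qed.

Lemma Rintegral_dilate n (D : set (rtuple n)) (f : rtuple n -> R) :
  measurable D -> (tuple_lebesgue R n D < +oo)%E -> bmeas D f ->
  \int[tuple_lebesgue R n]_(t in D) f t =
  r%:num ^+ n * \int[tuple_lebesgue R n]_(t in @tdilate n @^-1` D) f (tdilate t).
Proof.
move=> mD fD bf; set mu := tuple_lebesgue R n.
have mD' : measurable (@tdilate n @^-1` D).
  by rewrite -[X in measurable X]setTI; exact: measurable_tdilate.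
have fD' : (mu (@tdilate n @^-1` D) < +oo)%E.
  move: fD; rewrite tuple_lebesgue_dilate // -/mu; case: (mu _) => //= [x|];
    rewrite ?ltey //.
  by rewrite gt0_muley // lte_fin exprn_gt0.
have bf' : bmeas (@tdilate n @^-1` D) (fun t => f (tdilate t)).
  split; last by have [M fM] := bf.2; exists M => t; apply: fM.
  apply: (@measurable_comp _ _ _ _ _ _ D f) => //; last first.
  - by apply: measurable_funTS; exact: measurable_tdilate.
  - exact: bf.1.
  - by move=> _ [t Dt <-].
have ge0 (g : rtuple n -> R) : (forall t, D t -> 0 <= g t) -> measurable_fun D g ->
    \int[mu]_(t in D) g t = r%:num ^+ n * \int[mu]_(t in @tdilate n @^-1` D) g
      (tdilate t).
  move=> g0 mg; rewrite /Rintegral.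
  rewrite (eq_measure_integral (scaled_pushforward (r%:num ^+ n)%:nng mu
    (@measurable_tdilate n))).
    rewrite ge0_integral_scaled_pushforward //; last exact/measurable_EFinP.
    have : (0 <= \int[mu]_(t in @tdilate n @^-1` D) (g (tdilate t))%:E)%E.
      by apply: integral_ge0 => t Dt; rewrite lee_fin; exact: g0.
    (* If the integral is infinite, [fine] sends both sides to 0; the value -oo is excluded by
       positivity. *)
    case: (integral _ _ _) => [x _|_|] //=.
    by rewrite gt0_muley ?mulr0 // lte_fin exprn_gt0.
  by move=> B mB _; rewrite scaled_pushforwardE; exact: tuple_lebesgue_dilate.
have [M fM] := bf.2.
have bcst E : bmeas E (cst M : rtuple n -> R) by exact: bmeas_cst.
(* A signed [f] bounded by [M] is reduced to the nonnegative case through f = (f + M) - M. *)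
have fMD E (h : rtuple n -> R) : measurable E -> (mu E < +oo)%E -> bmeas E h ->
    \int[mu]_(t in E) h t = \int[mu]_(t in E) (h t + M) - \int[mu]_(t in E) M.
  move=> mE fE bh; rewrite -RintegralB //.
  - by apply: eq_Rintegral => t _; rewrite addrK.
  - by apply: bmeas_integrable => //; apply: bmeasD.
  - exact: bmeas_integrable.
rewrite (fMD D) // (fMD _ (f \o _)) // mulrBr; congr (_ - _).
  apply: (ge0 (fun t => f t + M)).
    by move=> t Dt; have := fM _ Dt; rewrite ler_norml => /andP[+ _];
      rewrite -subr_ge0 opprK.
  by apply: measurable_funD => //; exact: bf.1.
by apply: (ge0 (cst M)) => // t Dt; rewrite (le_trans (normr_ge0 _) (fM _ Dt)).
Qed.

End Scaling.

(** * Integration over Euclidean balls *)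

Section Dot.
Variables (R : realType) (m : nat).
Implicit Types x y z : 'rV[R]_m.

Lemma dotC x y : dot x y = dot y x.
Proof. by apply: eq_bigr => j _; rewrite mulrC. Qed.

Lemma dotDr x y z : dot x (y + z) = dot x y + dot x z.
Proof. by rewrite -big_split; apply: eq_bigr => j _; rewrite mxE mulrDr. Qed.

Lemma dotZr x (a : R) y : dot x (a *: y) = a * dot x y.
Proof. by rewrite mulr_sumr; apply: eq_bigr => j _; rewrite mxE mulrCA. Qed.

Lemma dotZl x (a : R) y : dot (a *: x) y = a * dot x y.
Proof. by rewrite dotC dotZr dotC. Qed.

Lemma dot_delta x j : dot x (delta_mx 0 j) = x 0 j.
Proof.
rewrite /dot (bigD1 j) //= mxE !eqxx mulr1 big1 ?addr0 // => i ij.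
by rewrite mxE (negbTE ij) andbF mulr0.
Qed.

Lemma dot_ge0 x : 0 <= dot x x.
Proof. by apply: sumr_ge0 => j _; rewrite -expr2 sqr_ge0. Qed.

Lemma enorm_sqr x : enorm x ^+ 2 = dot x x.
Proof. by rewrite sqr_sqrtr // dot_ge0. Qed.

Lemma enorm_ge0 x : 0 <= enorm x.
Proof. exact: sqrtr_ge0. Qed.

Lemma enormZ (a : R) x : 0 <= a -> enorm (a *: x) = a * enorm x.
Proof.
move=> a0; rewrite /enorm dotZr dotZl mulrA -expr2 sqrtrM ?sqr_ge0 //.
by rewrite sqrtr_sqr ger0_norm.
Qed.

Lemma enorm_leE x (r : R) : 0 <= r -> (enorm x <= r) = (dot x x <= r ^+ 2).
Proof. by move=> r0; rewrite -enorm_sqr ler_sqr ?nnegrE ?enorm_ge0. Qed.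

Lemma enorm_lt1E x : (enorm x < 1) = (dot x x < 1).
Proof.
by rewrite -enorm_sqr -[X in _ = (_ < X)](expr1n _ 2) ltr_sqr ?nnegrE ?enorm_ge0.
Qed.

Lemma coord_le_enorm x j : `|x 0 j| <= enorm x.
Proof.
rewrite -(ler_sqr (normr_ge0 _) (enorm_ge0 _)) enorm_sqr real_normK ?num_real //.
by rewrite /dot (bigD1 j) //= -expr2 lerDl sumr_ge0 // => i _; rewrite -expr2 sqr_ge0.
Qed.

Lemma dot_le_ball x (r : R) : 0 <= r -> cball r x -> dot x x <= r ^+ 2.
Proof. by move=> r0; rewrite /cball /= enorm_leE. Qed.

Lemma cball_dot_itv x : cball 1 x -> 0 <= dot x x <= 1.
Proof. by move/(dot_le_ball ler01); rewrite expr1n dot_ge0. Qed.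

End Dot.

Section Ball.
Variables (R : realType) (m : nat).
Local Notation T := (m.-tuple (measurableTypeR R)).
Local Notation mu := (tuple_lebesgue R m).
Implicit Types (f g : 'rV[R]_m -> R) (D : set 'rV[R]_m) (r : R).
Local Notation row := (@row_of_tuple R m).

Definition emeas f := measurable_fun setT (f \o row).

Definition ebmeas D f := bmeas (row @^-1` D) (f \o row).

Lemma emeas_coord j : emeas (fun x => x 0 j).
Proof.
rewrite /emeas (_ : _ \o _ = (@tnth m R)^~ j); first exact: measurable_tnth.
by apply/funext => t /=; rewrite mxE.
Qed.

Lemma emeas_cst r : emeas (cst r).
Proof. exact: measurable_cst. Qed.

Lemma emeasD f g : emeas f -> emeas g -> emeas (fun x => f x + g x).
Proof. exact: measurable_funD. Qed.

Lemma emeasM f g : emeas f -> emeas g -> emeas (fun x => f x * g x).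
Proof. exact: measurable_funM. Qed.

Lemma emeas_sum (I : Type) (s : seq I) (P : pred I) (F : I -> 'rV[R]_m -> R) :
  (forall i, emeas (F i)) -> emeas (fun x => \sum_(i <- s | P i) F i x).
Proof.
move=> bF; elim: s => [|i s IHs].
  under [X in emeas X]eq_fun do rewrite big_nil; exact: emeas_cst.
under [X in emeas X]eq_fun do rewrite big_cons.
by case: (P i) => //; apply: emeasD.
Qed.

Lemma emeas_prod (I : Type) (s : seq I) (P : pred I) (F : I -> 'rV[R]_m -> R) :
  (forall i, emeas (F i)) -> emeas (fun x => \prod_(i <- s | P i) F i x).
Proof.
move=> bF; elim: s => [|i s IHs].
  under [X in emeas X]eq_fun do rewrite big_nil; exact: emeas_cst.
under [X in emeas X]eq_fun do rewrite big_cons.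
by case: (P i) => //; apply: emeasM.
Qed.

Lemma emeasX f n : emeas f -> emeas (fun x => f x ^+ n).
Proof. exact: measurable_funX. Qed.

Lemma emeas_dot y : emeas (fun x => dot x y).
Proof. by apply: emeas_sum => j; apply: emeasM; [exact: emeas_coord|exact:
  emeas_cst]. Qed.

Lemma emeas_dotxx : emeas (fun x => dot x x).
Proof. by apply: emeas_sum => j; apply: emeasM; exact: emeas_coord. Qed.

Lemma emeas_comp (F : R -> R) f : continuous F -> emeas f -> emeas (F \o f).
Proof.
move=> cF mf; rewrite /emeas -compA; apply: measurableT_comp => //.
exact: continuous_measurable_fun.
Qed.

Lemma ebmeasW D f r : measurable (row @^-1` D) -> emeas f ->
  (forall x, D x -> `|f x| <= r) -> ebmeas D f.
Proof.
move=> mD mf fr; split; first exact: measurable_funTS.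
by exists r => t Dt; exact: fr.
Qed.

Lemma measurable_cball r : measurable (row @^-1` cball r).
Proof.
have [r0|r0] := leP 0 r; last first.
  rewrite (_ : _ @^-1` _ = set0) //; apply/seteqP; split => // t /= /(le_lt_trans)/(_ r0).
  by rewrite ltNge enorm_ge0.
rewrite (_ : _ @^-1` _ = ((fun x => dot x x) \o row) @^-1` `]-oo, r ^+ 2]%classic).
  by rewrite -[X in measurable X]setTI; apply: emeas_dotxx => //; exact: measurable_itv.
by apply/seteqP; split => t /=; rewrite /cball /= in_itv /= enorm_leE.
Qed.

Lemma cball_lty r : (mu (row @^-1` cball r) < +oo)%E.
Proof.
have [r0|r0] := leP 0 r; last first.
  rewrite (_ : _ @^-1` _ = set0) ?measure0 //.
  apply/seteqP; split => // t /= /(le_lt_trans)/(_ r0).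
  by rewrite ltNge enorm_ge0.
have /(@tuple_lebesgue_box R m) h : forall i : 'I_m, - r <= r by move=> _; lra.
 apply: (@le_lt_trans _ _ (mu (tuple_box (fun=> - r) (fun=> r)))); last first.
  by rewrite h ltry.
apply: le_measure; rewrite ?inE; [exact: measurable_cball|exact: measurable_tuple_box|].
move=> t /= bt i; rewrite in_itv /= -ler_norml.
by have := coord_le_enorm (row t) i; rewrite mxE => /le_trans; apply.
Qed.

Lemma ebmeas_integrable f r : ebmeas (cball r) f ->
  mu.-integrable (row @^-1` cball r) (EFin \o (f \o row)).
Proof.
by apply: bmeas_integrable; [exact: measurable_cball|exact: cball_lty].
Qed.

Lemma preimage_dilate_cball (r : {posnum R}) :
  @tdilate R r m @^-1` (row @^-1` cball r%:num) = row @^-1` cball 1.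
Proof.
have e t : row (tdilate r t) = r%:num *: row t.
  by apply/rowP => j; rewrite !mxE tnth_map.
by apply/seteqP; split => t /=;
  rewrite /cball /= e enormZ // ger_pMr.
Qed.

Lemma eint_dilate r f : 0 < r -> ebmeas (cball r) f ->
  eint (cball r) f = r ^+ m * eint (cball 1) (fun x => f (r *: x)).
Proof.
move=> r0 bf; pose p := PosNum r0.
rewrite /eint (Rintegral_dilate p) //; [|exact: measurable_cball|exact: cball_lty].
rewrite (preimage_dilate_cball p); congr (_ * _).
apply: eq_Rintegral => t _ /=; congr f.
by apply/rowP => j; rewrite !mxE tnth_map.
Qed.

Let preimage_setD D D' : row @^-1` (D `\` D') = (row @^-1` D) `\` (row @^-1` D').
Proof. by []. Qed.

Definition ball_volume : R := fine (mu (row @^-1` cball 1)).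

Lemma ball_volume_ge0 : 0 <= ball_volume.
Proof. by rewrite fine_ge0. Qed.

(** Dilation gives the ball of radius [r] the volume r^m times that of the unit ball, and 1 - r^m <=
    m (1 - r) by Bernoulli. The linear decay in 1 - r is what the divergence identity needs. *)
Lemma annulus_volume r : 0 < r -> r <= 1 ->
  fine (mu (row @^-1` (cball 1 `\` cball r))) <= m%:R * (1 - r) * ball_volume.
Proof.
move=> r0 r1; pose p := PosNum r0.
have cr : cball r `<=` (cball 1 : set 'rV[R]_m).
  by move=> x /= xr; exact: le_trans xr r1.
have fb : (mu (row @^-1` cball 1) \is a fin_num).
  by rewrite ge0_fin_numE // cball_lty.
rewrite preimage_setD measureD; last 3 first.
- exact: measurable_cball.
- exact: measurable_cball.
- exact: cball_lty.
rewrite setIidr; last by move=> t; exact: cr.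
rewrite [X in (_ - X)%E](tuple_lebesgue_dilate p); last exact: measurable_cball.
rewrite (preimage_dilate_cball p) /=.
rewrite -(fineK fb) -EFinM -EFinD /= -/ball_volume.
rewrite -[X in X - _]mul1r -mulrBl ler_wpM2r ?ball_volume_ge0 //.
elim: m => [|n IHn]; first by rewrite expr0 subrr mul0r.
rewrite exprS -natr1.
have rn : r ^+ n <= 1 by rewrite exprn_ile1 // ltW.
have rn0 : 0 <= r ^+ n by rewrite exprn_ge0 // ltW.
by nra.
Qed.

(** The sphere lies in every annulus r < |x| <= 1, and these have arbitrarily small volume. *)
Lemma sphere_null : mu (row @^-1` [set x | enorm x = 1]) = 0%E.
Proof.
have mS : measurable (row @^-1` [set x | enorm x = 1]).
  rewrite (_ : _ @^-1` _ = ((fun x => dot x x) \o row) @^-1` [set 1]).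
    by rewrite -[X in measurable X]setTI; apply: emeas_dotxx.
  apply/seteqP; split => t /= e; first by rewrite -enorm_sqr e expr1n.
  by rewrite /enorm e sqrtr1.
have Sann r : 0 < r -> r < 1 -> (mu (row @^-1` [set x | enorm x = 1%R]) <=
     mu (row @^-1` (cball 1%R `\` cball r)))%E.
  move=> r0 r1; apply: le_measure; rewrite ?inE //.
    by rewrite preimage_setD; apply: measurableD; exact: measurable_cball.
  by move=> t /= e; split; rewrite /cball /= e // leNgt r1.
have ann_lty r : (mu (row @^-1` (cball 1%R `\` cball r)) < +oo)%E.
  apply: le_lt_trans (cball_lty 1); apply: le_measure; rewrite ?inE.
  - by rewrite preimage_setD; apply: measurableD; exact: measurable_cball.
  - exact: measurable_cball.
  - by move=> t [].
have S_fin : mu (row @^-1` [set x | enorm x = 1]) \is a fin_num.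
  rewrite ge0_fin_numE //; apply: le_lt_trans (ann_lty (1/2)).
  by apply: Sann; lra.
rewrite -(fineK S_fin); congr EFin; apply/eqP; rewrite eq_le fine_ge0 // andbT.
apply/ler_addgt0Pl => e e0; rewrite addr0.
pose K := m%:R * ball_volume.
have K0 : 0 <= K by rewrite mulr_ge0 ?ball_volume_ge0.
(* The bound 1/2 keeps [r] positive, the other one makes K (1 - r) <= e; K + 1 avoids a division by
   0. *)
pose r := 1 - Num.min (1/2) (e / (K + 1)).
have d0 : 0 < Num.min (1/2) (e / (K + 1)).
  rewrite lt_min; apply/andP; split; first by lra.
  by rewrite divr_gt0 // ltr_wpDl.
have d1 : Num.min (1/2) (e / (K + 1)) <= 1/2 by rewrite ge_min lexx.
have d2 : Num.min (1/2) (e / (K + 1)) <= e / (K + 1) by rewrite ge_min lexx orbT.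
have r0 : 0 < r by rewrite /r; lra.
have r1 : r < 1 by rewrite /r; lra.
apply: (@le_trans _ _ (fine (mu (row @^-1` (cball 1 `\` cball r))))).
  by rewrite fine_le ?Sann // ge0_fin_numE.
apply: (le_trans (annulus_volume r0 (ltW r1))).
rewrite /r subKr mulrAC -/K.
apply: (@le_trans _ _ (K * (e / (K + 1)))); first by rewrite ler_wpM2l.
rewrite mulrCA ger_pMr // ler_pdivrMr ?mul1r ?lerDl //.
by rewrite ltr_wpDl.
Qed.

(** The eigenvalue equation holds on the ball only, so derivatives of its two sides can be compared
    only at interior points. This lemma makes that sufficient under the integral. *)
Lemma eq_eint_open_ball f g : ebmeas (cball 1) f -> ebmeas (cball 1) g ->
  (forall x, enorm x < 1 -> f x = g x) -> eint (cball 1) f = eint (cball 1) g.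
Proof.
move=> [mf _] [mg _] fg; congr fine.
apply: ae_eq_integral; [exact: measurable_cball|exact/measurable_EFinP..|].
exists (row @^-1` [set x | enorm x = 1]); split.
- rewrite (_ : _ @^-1` _ = ((fun x => dot x x) \o row) @^-1` [set 1]).
    by rewrite -[X in measurable X]setTI; apply: emeas_dotxx.
  apply/seteqP; split => t /= e; first by rewrite -enorm_sqr e expr1n.
  by rewrite /enorm e sqrtr1.
- exact: sphere_null.
- move=> t /= /not_implyP[t1 nfg]; apply/eqP; rewrite eq_le t1 /= leNgt.
  by apply/negP => /fg/= e; apply: nfg; rewrite e.
Qed.

End Ball.

(** * Superpositions of waves *)

(** Every directional derivative in R^m below is reduced to a derivative in one real variable by
    this lemma. *)
Lemma is_derive_line (R : realType) (V W : normedModType R) (f : V -> W) x v d :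
  is_derive (0 : R) 1 (fun h => f (h *: v + x)) d -> is_derive x v f d.
Proof.
move=> [dh <-]; apply: DeriveDef; first exact: (derivable1P f x v).2.
rewrite /derive; set g1 := fun h => h^-1 *: _; set g2 := fun h => h^-1 *: _.
suff -> : g1 = g2 by [].
by apply/funext => h; rewrite /g1 /g2 /= addr0 scale0r add0r [_%:A]mulr1.
Qed.

Section ProductMeasurable.
Context d1 d2 (T1 : measurableType d1) (T2 : measurableType d2) (R : realType).
Variables (D1 : set T1) (D2 : set T2).

Lemma bmeas_fst (f : T1 -> R) : measurable D1 -> bmeas D1 f -> bmeas (D1 `*` D2)
  (fun p => f p.1).
Proof.
move=> mD [mf [M fM]]; split; last by exists M => -[x y] [/= Dx _]; exact: fM.
apply: (@measurable_comp _ _ _ _ _ _ D1 f) => //.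
- by move=> _ [[x y] [Dx _] <-].
- by apply: measurable_funTS; exact: measurable_fst.
Qed.

Lemma bmeas_snd (f : T2 -> R) : measurable D2 -> bmeas D2 f -> bmeas (D1 `*` D2)
  (fun p => f p.2).
Proof.
move=> mD [mf [M fM]]; split; last by exists M => -[x y] [/= _ Dy]; exact: fM.
apply: (@measurable_comp _ _ _ _ _ _ D2 f) => //.
- by move=> _ [[x y] [_ Dy] <-].
- by apply: measurable_funTS; exact: measurable_snd.
Qed.

End ProductMeasurable.

Section Wave.
Variables (R : realType) (m : nat).
Local Notation T := (m.-tuple (measurableTypeR R)).
Local Notation mu := (tuple_lebesgue R m).
Local Notation row := (@row_of_tuple R m).
Implicit Types (a b f g : 'rV[R]_m -> R) (x v : 'rV[R]_m) (c : R).

Definition phase (xi x : 'rV[R]_m) : R := 2 * pi * dot xi x.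

(** This is the real part of the inverse Fourier integral of a - i b over the ball of radius [c].
    For real f the Fourier transform is the cosine transform minus i times the sine transform, so
    these two are the [a] and [b] of P_c f. *)
Definition swave c a b x : R :=
  eint (cball c) (fun xi => cos (phase xi x) * a xi + sin (phase xi x) * b xi).

Definition cos_transform g xi : R := eint (cball 1) (fun x => cos (phase xi x) * g x).
Definition sin_transform g xi : R := eint (cball 1) (fun x => sin (phase xi x) * g x).

Let bcos d (X : measurableType d) (D : set X) (f : X -> R) :
  measurable_fun setT f -> bmeas D (fun t => cos (f t)).
Proof.
move=> mf; split; last by exists 1 => x _; rewrite ler_norml cos_geN1 cos_le1.
apply: measurable_funTS; apply: measurableT_comp mf.
apply: continuous_measurable_fun; exact: continuous_cos.
Qed.

Let bsin d (X : measurableType d) (D : set X) (f : X -> R) :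
  measurable_fun setT f -> bmeas D (fun t => sin (f t)).
Proof.
move=> mf; split; last by exists 1 => x _; rewrite ler_norml sin_geN1 sin_le1.
apply: measurable_funTS; apply: measurableT_comp mf.
apply: continuous_measurable_fun; exact: continuous_sin.
Qed.

Let mphase x : measurable_fun setT (fun t => phase (row t) x).
Proof. by apply: measurable_funM => //; exact: emeas_dot. Qed.

Let mphase2 : measurable_fun setT (fun p : T * T => phase (row p.2) (row p.1)).
Proof.
apply: measurable_funM => //; rewrite /dot.
have mtnth (q : T * T -> T) j : measurable_fun setT q -> measurable_fun setT (fun
  p => row (q p) 0 j).
  move=> mq; exact: (measurableT_comp (@emeas_coord R m j) mq).
elim: (index_enum _) => [|j s IHs].
  by under eq_fun do rewrite big_nil; exact: measurable_cst.
under eq_fun do rewrite big_cons.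
by apply: measurable_funD => //; apply: measurable_funM; apply: mtnth.
Qed.

Lemma ebmeas_wave c a b x : ebmeas (cball c) a -> ebmeas (cball c) b ->
  ebmeas (cball c) (fun xi => cos (phase xi x) * a xi + sin (phase xi x) * b xi).
Proof.
move=> ba bb; apply: bmeasD; apply: bmeasM => //.
- exact: bcos.
- exact: bsin.
Qed.

Lemma ebmeas_dot c v : 0 <= c -> ebmeas (cball c) (fun xi => dot xi v).
Proof.
move=> c0; apply: (@ebmeasW _ _ _ _ (\sum_j c * `|v 0 j|));
  [exact: measurable_cball|exact: emeas_dot|].
move=> xi xic; apply: le_trans (ler_norm_sum _ _ _) _; apply: ler_sum => j _.
by rewrite normrM ler_wpM2r // (le_trans (coord_le_enorm _ _)).
Qed.

(** Differentiation under the integral, dominated by |phase xi v| (|a| + |b|), which does not depend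
    on the point. The result is again a superposition of waves, so the lemma can be iterated. *)
Lemma is_derive_swave c a b x v : 0 <= c -> ebmeas (cball c) a -> ebmeas (cball c) b ->
  is_derive x v (swave c a b)
    (swave c (fun xi => phase xi v * b xi) (fun xi => - (phase xi v * a xi)) x).
Proof.
move=> c0 ba bb; apply: is_derive_line.
pose f (h : R) (t : T) := cos (phase (row t) (h *: v + x)) * a (row t) +
  sin (phase (row t) (h *: v + x)) * b (row t).
pose G (t : T) : R := `|phase (row t) v| * (`|a (row t)| + `|b (row t)|).
have bn D (g : T -> R) : bmeas D g -> bmeas D (fun t => `|g t|).
  move=> [mg [M gM]]; split; first by apply: measurableT_comp => //;
    exact: normr_measurable.
  by exists M => t Dt; rewrite normr_id gM.
have bphase : ebmeas (cball c) (fun xi => phase xi v) by apply: bmeasZ; exact: ebmeas_dot.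
have iG : mu.-integrable (row @^-1` cball c) (EFin \o G).
  apply: (bmeas_integrable (@measurable_cball R m c) (@cball_lty R m c)).
  apply: bmeasM; first exact: bn.
  by apply: bmeasD; exact: bn.
have df (h : R) t : is_derive h 1 (f ^~ t)
   (cos (phase (row t) (h *: v + x)) * (phase (row t) v * b (row t)) +
    sin (phase (row t) (h *: v + x)) * (- (phase (row t) v * a (row t)))).
  have dl : is_derive h 1 (fun h : R => phase (row t) (h *: v + x)) (phase (row t) v).
    rewrite (_ : (fun h => _) = fun h => phase (row t) v * h + phase (row t) x).
      by apply: is_derive_eq; rewrite ?scaler0 ?addr0 ?mulr0 ?mulr1 ?add0r; exact: mulr1.
    by apply/funext => u; rewrite /phase dotDr dotZr; ring.
  rewrite /f; apply: is_derive_eq.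
  rewrite /= !scaler0 !add0r /GRing.scale /=; ring.
have intf h : mu.-integrable (row @^-1` cball c) (EFin \o f h).
  by apply: (bmeas_integrable (@measurable_cball R m c) (@cball_lty R m c));
    exact: ebmeas_wave.
have I0 : `]-1, 1[%classic (0 : R) by rewrite /= in_itv /=; lra.
have Gub h t : `|partial1of2 f h t| <= G t.
  rewrite /partial1of2 derive1E (@derive_val _ _ _ _ _ _ _ (df h t)).
  rewrite mulrN mulrCA [X in _ - X]mulrCA -mulrBr normrM ler_wpM2l //.
  rewrite [X in _ <= X]addrC (le_trans (ler_normB _ _)) // lerD // normrM.
    by rewrite ler_piMl // ler_norml cos_geN1 cos_le1.
  by rewrite ler_piMl // ler_norml sin_geN1 sin_le1.
have der := @derivable_under_integral R _ T mu f _ (@measurable_cball R m c) 0 (-1) 1 I0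
  (fun h _ => intf h) (fun h t _ _ => @ex_derive _ _ _ _ _ _ _ (df h t)) G (fun t
    => mulr_ge0 (normr_ge0 _) (addr_ge0 (normr_ge0 _) (normr_ge0 _))) iG (fun h t
      _ _ => Gub h t).
have dif := @differentiation_under_integral R _ T mu f _ (@measurable_cball R m
  c) 0 (-1) 1 I0
  (fun h _ => intf h) (fun h t _ _ => @ex_derive _ _ _ _ _ _ _ (df h t)) G (fun t
    => mulr_ge0 (normr_ge0 _) (addr_ge0 (normr_ge0 _) (normr_ge0 _))) iG (fun h t
      _ _ => Gub h t).
apply: DeriveDef; first exact: der.
rewrite -derive1E dif; apply: eq_Rintegral => t _.
rewrite /partial1of2 derive1E (@derive_val _ _ _ _ _ _ _ (df 0 t)).
by rewrite scale0r add0r.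
Qed.

Section Pairing.
Variables (c : R) (a b g : 'rV[R]_m -> R).
Hypotheses (ba : ebmeas (cball c) a) (bb : ebmeas (cball c) b).
Hypothesis bg : ebmeas (cball 1) g.
Local Notation D1 := (row @^-1` cball 1).
Local Notation Dc := (row @^-1` cball c).

Let F (p : T * T) := (cos (phase (row p.2) (row p.1)) * a (row p.2) +
   sin (phase (row p.2) (row p.1)) * b (row p.2)) * g (row p.1).

Let mD1 : measurable D1 := @measurable_cball R m 1.
Let mDc : measurable Dc := @measurable_cball R m c.
Let fD1 : (mu D1 < +oo)%E := @cball_lty R m 1.
Let fDc : (mu Dc < +oo)%E := @cball_lty R m c.

Let bF : bmeas (D1 `*` Dc) F.
Proof.
apply: bmeasM; last exact: (bmeas_fst _ mD1 bg).
apply: bmeasD; apply: bmeasM; first exact: bcos.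
- exact: (bmeas_snd _ mDc ba).
- exact: bsin.
- exact: (bmeas_snd _ mDc bb).
Qed.

(** Fubini: the adjoint of building a superposition from [a] and [b] is taking the cosine and sine
    transforms. *)
Lemma swave_pairing :
  eint (cball 1) (fun x => swave c a b x * g x) =
  eint (cball c) (fun xi => a xi * cos_transform g xi + b xi * sin_transform g xi).
Proof.
transitivity (\int[mu]_(t in D1) (\int[mu]_(u in Dc) F (t, u))).
  apply: eq_Rintegral => t _; rewrite /F /= RintegralZr //.
  by apply: (bmeas_integrable mDc fDc); exact: ebmeas_wave.
rewrite (Rintegral_swap mD1 mDc fD1 fDc bF); apply: eq_Rintegral => u _.
have bc : bmeas D1 (fun t => cos (phase (row u) (row t)) * g (row t)).
  apply: bmeasM => //; apply: bcos; rewrite /phase.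
  by under eq_fun do rewrite dotC; exact: mphase.
have bs : bmeas D1 (fun t => sin (phase (row u) (row t)) * g (row t)).
  apply: bmeasM => //; apply: bsin; rewrite /phase.
  by under eq_fun do rewrite dotC; exact: mphase.
rewrite -RintegralZl -?RintegralZl -?RintegralD //; try exact: bmeas_integrable.
- by apply: eq_Rintegral => t _; rewrite /F /=; ring.
- by apply: bmeas_integrable => //; exact: bmeasZ.
- by apply: bmeas_integrable => //; exact: bmeasZ.
Qed.

End Pairing.

Lemma ebmeas_swave c a b : ebmeas (cball c) a -> ebmeas (cball c) b ->
  ebmeas (cball 1) (swave c a b).
Proof.
move=> ba bb.
pose F (p : T * T) := cos (phase (row p.2) (row p.1)) * a (row p.2) +
   sin (phase (row p.2) (row p.1)) * b (row p.2).
apply: (@bmeas_Rintegral _ _ _ _ _ mu mu _ _ (@measurable_cball R m 1)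
  (@measurable_cball R m c) (@cball_lty R m 1) (@cball_lty R m c) F).
apply: bmeasD; apply: bmeasM; first exact: bcos.
- exact: (bmeas_snd _ (@measurable_cball R m c) ba).
- exact: bsin.
- exact: (bmeas_snd _ (@measurable_cball R m c) bb).
Qed.

Lemma ebmeas_cos_transform c g : ebmeas (cball 1) g ->
  ebmeas (cball c) (cos_transform g).
Proof.
move=> bg.
pose F (p : T * T) := cos (phase (row p.1) (row p.2)) * g (row p.2).
apply: (@bmeas_Rintegral _ _ _ _ _ mu mu _ _ (@measurable_cball R m c)
  (@measurable_cball R m 1) (@cball_lty R m c) (@cball_lty R m 1) F).
apply: bmeasM; last exact: (bmeas_snd _ (@measurable_cball R m 1) bg).
by apply: bcos; rewrite /phase; under eq_fun do rewrite dotC; exact: mphase2.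
Qed.

Lemma ebmeas_sin_transform c g : ebmeas (cball 1) g ->
  ebmeas (cball c) (sin_transform g).
Proof.
move=> bg.
pose F (p : T * T) := sin (phase (row p.1) (row p.2)) * g (row p.2).
apply: (@bmeas_Rintegral _ _ _ _ _ mu mu _ _ (@measurable_cball R m c)
  (@measurable_cball R m 1) (@cball_lty R m c) (@cball_lty R m 1) F).
apply: bmeasM; last exact: (bmeas_snd _ (@measurable_cball R m 1) bg).
by apply: bsin; rewrite /phase; under eq_fun do rewrite dotC; exact: mphase2.
Qed.

End Wave.

(** * The Dirac operator on radial modes *)

Section CliffordDot.
Variables (R : realType) (m : nat).
Implicit Types (u v w : clifford R m) (x : 'rV[R]_m).
Local Notation e j := (clgen R j).

Definition cldot u v : R := \sum_A u A * v A.

Lemma cldotE u v : cldot u v = (clconj u * v) finset.set0.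
Proof.
rewrite clmulE; apply: eq_bigr => A _.
by rewrite symdiff0 ffunE mulrA -signr_addb addbb mul1r.
Qed.

Lemma cldotC u v : cldot u v = cldot v u.
Proof. by apply: eq_bigr => A _; rewrite mulrC. Qed.

Lemma cldot_suml (I : Type) (s : seq I) (P : pred I) (F : I -> clifford R m) v :
  cldot (\sum_(i <- s | P i) F i) v = \sum_(i <- s | P i) cldot (F i) v.
Proof.
rewrite exchange_big; apply: eq_bigr => A _.
by rewrite sum_ffunE mulr_suml.
Qed.

Lemma cldotZl (a : R) u v : cldot (a *: u) v = a * cldot u v.
Proof. by rewrite mulr_sumr; apply: eq_bigr => A _; rewrite ffunE -mulrA. Qed.

Lemma cldotZr (a : R) u v : cldot u (a *: v) = a * cldot u v.
Proof. by rewrite cldotC cldotZl cldotC. Qed.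

Lemma cldotNl u v : cldot (- u) v = - cldot u v.
Proof. by rewrite -scaleN1r cldotZl mulN1r. Qed.

(** Conjugation reverses products and sends e_j to - e_j, so left multiplication by a vector is
    skew. The symmetry of the Dirac operator on eigenfunctions rests on this sign. *)
Lemma cldot_gen j u v : cldot (e j * u) v = - cldot u (e j * v).
Proof. by rewrite !cldotE clconjM clconj_gen mulrN mulNr ffunE mulrA. Qed.

Lemma cldot_clvec x u v : cldot (clvec x * u) v = - cldot u (clvec x * v).
Proof.
rewrite /clvec !mulr_suml cldot_suml [in RHS]cldotC cldot_suml -sumrN.
apply: eq_bigr => j _; rewrite -!clscaleAl !cldotZl cldot_gen mulrN.
by rewrite [cldot (e j * v) u]cldotC.
Qed.

Lemma clsqnorm_cldot u : clsqnorm u = cldot u u.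
Proof. by apply: eq_bigr => A _; rewrite expr2. Qed.

Lemma clgen_clvec j x : e j * clvec x = - (clvec x * e j) - (2 * x 0 j) *: 1.
Proof.
have h : e j * clvec x + clvec x * e j = - ((2 * x 0 j) *: 1).
  rewrite /clvec mulr_sumr mulr_suml -big_split /=.
  rewrite (bigD1 j) //= big1 => [|i ij]; last first.
    rewrite -clscaleAr -clscaleAl -scalerDr (clgen_anti R ij).
    by rewrite subrr scaler0.
  rewrite -clscaleAr -clscaleAl clgen_sqr addr0 scalerN -opprD -scalerDl.
  by rewrite mulr_natl mulr2n.
by rewrite -[LHS](addrK (clvec x * e j)) h addrC.
Qed.

(** Moving each e_j past the second factor gives x x = - x x - 2 |x|^2, and 2 is invertible. *)
Lemma clvec_sqr x : clvec x * clvec x = - (dot x x) *: 1.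
Proof.
have h : clvec x * clvec x = - (clvec x * clvec x) - (2 * dot x x) *: 1.
  transitivity (\sum_j x 0 j *: (e j * clvec x)).
    by rewrite {1}/clvec mulr_suml; apply: eq_bigr => j _; rewrite clscaleAl.
  under eq_bigr do rewrite clgen_clvec scalerBr scalerN clscaleAr scalerA.
  rewrite sumrB sumrN -mulr_sumr -/(clvec x) -scaler_suml; congr (_ - _ *: _).
  by rewrite mulr_sumr; apply: eq_bigr => j _; rewrite mulrCA.
have h2 : 2 *: (clvec x * clvec x) = 2 *: (- (dot x x) *: 1).
  rewrite scalerA mulrN scaleNr scaler_nat mulr2n {2}h addrA subrr add0r.
  by [].
by apply: (@scalerI _ _ 2) h2; rewrite pnatr_eq0.
Qed.

Lemma clvec_clvec x u : clvec x * (clvec x * u) = - (dot x x) *: u.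
Proof. by rewrite mulrA clvec_sqr -clscaleAl mul1r. Qed.

Lemma cldot_clvec_clvec x u v : cldot (clvec x * u) (clvec x * v) = dot x x * cldot u v.
Proof. by rewrite cldot_clvec clvec_clvec cldotZr mulNr opprK. Qed.

End CliffordDot.

Section CliffordDerivative.
Variables (R : realType) (m : nat).
Implicit Types (f g : 'rV[R]_m -> clifford R m) (x v : 'rV[R]_m).
Local Notation e j := (clgen R j).

Lemma is_derive_bigsum (V : normedModType R) (I : Type) (s : seq I)
    (h : I -> V -> R) (dh : I -> R) (x v : V) :
  (forall i, is_derive x v (h i) (dh i)) ->
  is_derive x v (fun y => \sum_(i <- s) h i y) (\sum_(i <- s) dh i).
Proof.
move=> dhi; elim: s => [|i s IHs].
  rewrite big_nil; have -> : (fun y => \sum_(i <- [::]) h i y) = cst 0.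
    by apply/funext => y; rewrite big_nil.
  exact: is_derive_cst.
rewrite big_cons; have -> : (fun y => \sum_(j <- i :: s) h j y) = h i + fun y =>
  \sum_(j <- s) h j y.
  by apply/funext => y; rewrite big_cons.
exact: is_deriveD.
Qed.

Definition is_clderive x v f (df : clifford R m) :=
  forall A, is_derive x v (fun y => f y A : R) (df A).

Lemma partialE j f x df : is_clderive x (delta_mx 0 j) f df -> partial j f x = df.
Proof. by move=> fdf; apply/ffunP => A; rewrite ffunE (@derive_val _ _ _ _ _ _ _
  (fdf A)). Qed.

Lemma is_clderive_mull x v f df (a : clifford R m) : is_clderive x v f df ->
  is_clderive x v (fun y => a * f y) (a * df).
Proof.
move=> fdf C; rewrite clmulE.
under [X in is_derive _ _ X _]eq_fun do rewrite clmulE.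
apply: is_derive_bigsum => A.
rewrite (_ : (fun _ => _) = ((-1) ^+ clsign A (symdiff A C) * a A) \*: (fun y =>
  f y (symdiff A C) : R)) //.
exact: is_deriveZ.
Qed.

Lemma is_clderive_scale x v f df (g : 'rV[R]_m -> R) dg :
  is_derive x v g dg -> is_clderive x v f df ->
  is_clderive x v (fun y => g y *: f y) (dg *: f x + g x *: df).
Proof.
move=> gdg fdf C; have := is_deriveM gdg (fdf C).
rewrite (_ : (fun y => (g y *: f y) C) = g * (fun y => f y C)); last first.
  by apply/funext => y; rewrite ffunE.
move/is_derive_eq; apply.
by rewrite !ffunE /GRing.scale /= addrC [f x C * _]mulrC.
Qed.

Lemma is_clderive_sum (I : Type) (s : seq I) x v (F : I -> 'rV[R]_m -> clifford R m) dF :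
  (forall i, is_clderive x v (F i) (dF i)) ->
  is_clderive x v (fun y => \sum_(i <- s) F i y) (\sum_(i <- s) dF i).
Proof.
move=> FdF C; rewrite sum_ffunE.
under [X in is_derive _ _ X _]eq_fun do rewrite sum_ffunE.
by apply: is_derive_bigsum => i; exact: FdF.
Qed.

Lemma is_derive_coord x v j : is_derive x v (fun y => y 0 j : R) (v 0 j).
Proof.
apply: is_derive_line.
rewrite (_ : (fun h => _) = fun h : R => v 0 j * h + x 0 j); last first.
  by apply/funext => h; rewrite !mxE mulrC.
by apply: is_derive_eq; rewrite ?scaler0 ?addr0 ?mulr0 ?mulr1 ?add0r; exact: mulr1.
Qed.

Lemma is_derive_radial x v (F : R -> R) : derivable F (dot x x) 1 ->
  is_derive x v (fun y => F (dot y y)) (derive1 F (dot x x) * (2 * dot x v)).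
Proof.
move=> dF; apply: is_derive_line.
rewrite (_ : (fun h => _) = F \o (fun h : R => dot v v * h ^+ 2 + 2 * dot x v * h
  + dot x x)); last first.
  apply/funext => h /=; congr F.
  by rewrite dotDr dotZr !(dotC (h *: v + x)) !dotDr !dotZr [dot v x]dotC; ring.
apply: is_derive1_comp; last first.
  apply: is_derive_eq; rewrite /GRing.scale /=; ring.
rewrite expr2 !mulr0 !add0r derive1E; exact: derivableP.
Qed.

Lemma is_clderive_clvec_mul x v f df : is_clderive x v f df ->
  is_clderive x v (fun y => clvec y * f y) (clvec v * f x + clvec x * df).
Proof.
move=> fdf.
have -> : clvec v * f x + clvec x * df =
    \sum_j (v 0 j *: (e j * f x) + x 0 j *: (e j * df)).
  rewrite big_split /= /clvec !mulr_suml.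
  by congr (_ + _); apply: eq_bigr => j _; rewrite clscaleAl.
rewrite (_ : (fun y => _) = fun y : 'rV_m => \sum_j y 0 j *: (e j * f y)); last first.
  apply/funext => y; rewrite /clvec mulr_suml.
  by apply: eq_bigr => j _; rewrite clscaleAl.
apply: is_clderive_sum => j; apply: is_clderive_scale; first exact: is_derive_coord.
exact: is_clderive_mull.
Qed.

Lemma clvec_delta (j : 'I_m) : clvec (delta_mx 0 j) = e j.
Proof.
rewrite /clvec (bigD1 j) //= mxE !eqxx scale1r big1 ?addr0 // => i ij.
by rewrite mxE (negbTE ij) andbF scale0r.
Qed.

End CliffordDerivative.

Section Monogenic.
Variables (R : realType) (m k : nat) (Y : 'rV[R]_m -> clifford R m).
Hypothesis mY : monogenic k Y.
Local Notation e j := (clgen R j).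
Local Notation s := ((m + 2 * k)%:R : R).
Implicit Types (F : R -> R) (x v : 'rV[R]_m).

Lemma monogenicZ (r : R) x : Y (r *: x) = r ^+ k *: Y x.
Proof.
have [[a aY] _] := mY; rewrite !aY scaler_sumr; apply: eq_bigr => al /eqP alk.
rewrite scalerA; congr (_ *: _).
have -> : r ^+ k = \prod_j r ^+ al j by rewrite prodrXr; congr (_ ^+ _).
rewrite -big_split /=.
by apply: eq_bigr => j _; rewrite mxE exprMn.
Qed.

Lemma differentiable_monogenic A x : differentiable (fun y => Y y A : R) x.
Proof.
have [[a aY] _] := mY.
rewrite (_ : (fun y => _) = fun y : 'rV_m => \sum_(al : {ffun 'I_m -> 'I_k.+1} |
  (\sum_j al j == k)%N)
            (\prod_j y 0 j ^+ al j) * a al A); last first.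
  by apply/funext => y; rewrite aY sum_ffunE; apply: eq_bigr => al _; rewrite ffunE.
have dprod (al : {ffun 'I_m -> 'I_k.+1}) : differentiable (fun y : 'rV[R]_m =>
  \prod_j y 0 j ^+ al j) x.
  elim: (index_enum _) => [|j r IHr].
    by under eq_fun do rewrite big_nil; exact: differentiable_cst.
  under eq_fun do rewrite big_cons.
  apply: differentiableM => //; elim: (nat_of_ord _) => [|n IHn].
    by under eq_fun do rewrite expr0; exact: differentiable_cst.
  under eq_fun do rewrite exprS.
  by apply: differentiableM => //; exact: differentiable_coord.
elim: (index_enum _) => [|al r IHr].
  by under eq_fun do rewrite big_nil; exact: differentiable_cst.
under eq_fun do rewrite big_cons.
case: (_ == _)%N => //; apply: differentiableD => //; apply: differentiableM => //.
Qed.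

Lemma is_clderive_monogenic x v :
  is_clderive x v Y (\sum_j v 0 j *: partial j Y x).
Proof.
move=> A; have dY := differentiable_monogenic A x.
apply: DeriveDef; first exact: diff_derivable.
rewrite deriveE // {1}(row_sum_delta v) linear_sum sum_ffunE; apply: eq_bigr => j _.
by rewrite linearZ /= !ffunE deriveE.
Qed.

(** The derivative of [Y] at [x] in the direction [x] is computed twice: by linearity in the
    direction, and along the ray, where homogeneity turns it into the derivative of (t + 1)^k at
    0. *)
Lemma euler_monogenic x : \sum_j x 0 j *: partial j Y x = k%:R *: Y x.
Proof.
apply/ffunP => A; have h := is_clderive_monogenic x x A.
have h' : is_derive x x (fun y => Y y A : R) (k%:R * Y x A).
  apply: is_derive_line.
  rewrite (_ : (fun h => _) = Y x A \*: ((id + cst 1) ^+ k : R -> R)); last first.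
    apply/funext => t; rewrite -{2}(scale1r x) -scalerDl monogenicZ ffunE /= exprfctE.
    by rewrite /GRing.scale /= mulrC.
  apply: is_derive_eq; rewrite /GRing.scale /= !fctE add0r expr1n addr0.
  by rewrite !mulr1 mulrC.
rewrite -(@derive_val _ _ _ _ _ _ _ h) (@derive_val _ _ _ _ _ _ _ h').
by rewrite ffunE.
Qed.

(** Origin of the constant s = m + 2 k: the m squares e_j^2 = -1 give - m Y, commuting e_j past x
    leaves - x (D Y) = 0, and the correction terms - 2 x_j add up to - 2 k Y by Euler's identity. *)
Lemma dirac_clvec_monogenic x : dirac (fun y => clvec y * Y y) x = - s *: Y x.
Proof.
have p j : partial j (fun y => clvec y * Y y) x = e j * Y x + clvec x * partial j Y x.
  rewrite -clvec_delta; apply: partialE.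
  have -> : partial j Y x = \sum_i (delta_mx 0 j : 'rV[R]_m) 0 i *: partial i Y x.
    rewrite (bigD1 j) //= mxE !eqxx scale1r big1 ?addr0 // => i ij.
    by rewrite mxE (negbTE ij) andbF scale0r.
  exact/is_clderive_clvec_mul/is_clderive_monogenic.
rewrite /dirac; under eq_bigr => j _.
  rewrite p mulrDr !mulrA clgen_sqr mulN1r clgen_clvec mulrBl mulNr -mulrA
    -clscaleAl mul1r.
  over.
rewrite !big_split /= !sumrN sumr_const card_ord -mulr_sumr -/(dirac Y x) mY.2
  mulr0 oppr0 add0r.
under [X in _ - X]eq_bigr do rewrite -scalerA.
rewrite -scaler_sumr euler_monogenic -scaler_nat -opprD scalerA -scalerDl -scaleNr.
by congr (- _ *: _); rewrite natrD natrM.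
Qed.

Lemma dirac_radial_mul f (df : 'I_m -> clifford R m) F x :
  (forall j, is_clderive x (delta_mx 0 j) f (df j)) -> derivable F (dot x x) 1 ->
  dirac (fun y => F (dot y y) *: f y) x =
  (2 * derive1 F (dot x x)) *: (clvec x * f x) + F (dot x x) *: (\sum_j e j * df j).
Proof.
move=> fdf dF; rewrite /dirac.
under eq_bigr => j _.
  rewrite (partialE (is_clderive_scale (is_derive_radial _ dF) (fdf j))).
  rewrite dot_delta mulrDr -!clscaleAr; over.
rewrite big_split /= -scaler_sumr; congr (_ + _).
rewrite /clvec mulr_suml scaler_sumr; apply: eq_bigr => j _.
by rewrite -clscaleAl scalerA; congr (_ *: _); ring.
Qed.

Lemma even_modeE F : even_mode Y F = fun x => F (dot x x) *: Y x.
Proof. by apply/funext => x; rewrite /even_mode enorm_sqr. Qed.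

Lemma odd_modeE F : odd_mode Y F = fun x => F (dot x x) *: (clvec x * Y x).
Proof. by apply/funext => x; rewrite /odd_mode enorm_sqr. Qed.

Lemma dirac_even_mode F : (forall t, derivable F t 1) ->
  dirac (even_mode Y F) = odd_mode Y (fun t => 2 * derive1 F t).
Proof.
move=> dF; apply/funext => x; rewrite even_modeE odd_modeE.
rewrite (dirac_radial_mul (fun j => is_clderive_monogenic x (delta_mx 0 j))) //.
rewrite (_ : \sum_j _ = dirac Y x); first by rewrite mY.2 scaler0 addr0.
rewrite /dirac; apply: eq_bigr => j _; congr (_ * _).
rewrite (bigD1 j) //= mxE !eqxx scale1r big1 ?addr0 // => i ij.
by rewrite mxE (negbTE ij) andbF scale0r.
Qed.

Lemma dirac_odd_mode F : (forall t, derivable F t 1) ->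
  dirac (odd_mode Y F) = even_mode Y (fun t => - (2 * t * derive1 F t + s * F t)).
Proof.
move=> dF; apply/funext => x; rewrite even_modeE odd_modeE.
have d j := is_clderive_clvec_mul (is_clderive_monogenic x (delta_mx 0 j)).
rewrite (dirac_radial_mul d) // (_ : \sum_j _ = dirac (fun y => clvec y * Y y) x).
  rewrite dirac_clvec_monogenic clvec_clvec !scalerA -scalerDl; congr (_ *: _); ring.
by apply: eq_bigr => j _; rewrite (partialE (d j)).
Qed.

End Monogenic.

(** * Radial equations *)

Lemma continuous_itv01_bounded (R : realType) (F : R -> R) : continuous F ->
  exists2 M : R, 0 <= M & forall t : R, 0 <= t <= 1 -> `|F t| <= M.
Proof.
move=> cF; have cn : {within `[0, 1], continuous (fun t => `|F t|)}.
  apply: continuous_subspaceT => t; apply: continuous_comp; first exact: cF.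
  exact: norm_continuous.
have [c _ cmax] := EVT_max ler01 cn.
by exists `|F c| => // t t01; apply: cmax; rewrite in_itv.
Qed.

(** * Uniqueness at the singular endpoint t = 1 *)

Section SingularOde.
Variables (R : realType) (f f1 f2 : R -> R) (al q0 q1 : R).
Implicit Types t u : R.
Hypothesis al_ge0 : 0 <= al.
Hypothesis df : forall t : R, is_derive t 1 f (f1 t).
Hypothesis df1 : forall t : R, is_derive t 1 f1 (f2 t).
Hypothesis ode : forall t, 0 < t -> t <= 1 ->
  t * (1 - t) * f2 t = (t - al * (1 - t)) * f1 t + (q0 + q1 * t) * f t.
Hypothesis f_1 : f 1 = 0.

(* The energy (1 - t) f'^2 + f^2 has no singular coefficient at t = 1: there
   the term t f'^2 of its derivative has the right sign. *)
Lemma singular_ode_eq0_pos t : 0 < t -> t <= 1 -> f t = 0.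
Proof.
move=> t0 t1.
(* [K] bounds |q0 + q1 u + u| on [0, 1]. The two terms of [C] are chosen so that u C >= 2 al and u^2
   C >= K^2 for all u >= t. *)
pose K : R := `|q0| + `|q1| + 1; pose C : R := 2 * al / t + K ^+ 2 / t ^+ 2.
pose E : R -> R := (cst 1 - id) * (f1 * f1) + f * f.
pose dE u := - (f1 u ^+ 2) + (1 - u) * (2 * f1 u * f2 u) + 2 * f u * f1 u.
have dE_ (u : R) : is_derive u 1 E (dE u).
  apply: is_derive_eq; rewrite /GRing.scale /dE /= !fctE; ring.
(* With the integrating factor the energy is nondecreasing on [t, 1]; it is f(1)^2 = 0 at 1, hence
   E(t) <= 0 although both terms of E are nonnegative. *)
pose H : R -> R := E * (expR \o (fun u => C * u)).
have dexp (u : R) : is_derive u 1 (expR \o (fun u => C * u)) (expR (C * u) * C).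
  apply: is_derive1_comp; have := is_deriveZ C (is_derive_id u (1 : R)).
  by rewrite /GRing.scale /= mulr1.
have dH (u : R) : is_derive u 1 H ((dE u + C * E u) * expR (C * u)).
  by apply: is_derive_eq; rewrite /GRing.scale /=; ring.
have C0 : 0 <= C.
  apply: addr_ge0; apply: divr_ge0; try exact: sqr_ge0; first exact: mulr_ge0.
  exact: ltW.
have dH0 (u : R) : u \in `]t, 1[ -> 0 <= H^`()%classic u.
  rewrite in_itv /= => /andP[tu u1]; have u0 : 0 < u by exact: lt_trans tu.
  rewrite derive1E (@derive_val _ _ _ _ _ _ _ (dH u)).
  apply: mulr_ge0; last exact: expR_ge0.
  have := ode u0 (ltW u1); set q := q0 + q1 * u => odeu.
  have qK : `|q + u| <= K.
    rewrite /q /K (le_trans (ler_normD _ _)) // lerD //; last by rewrite ger0_norm ltW.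
    rewrite (le_trans (ler_normD _ _)) // lerD // normrM ler_piMr //.
    by rewrite ger0_norm ltW.
  have q2 : (q + u) ^+ 2 <= K ^+ 2.
    by rewrite -(real_normK (num_real (q + u))) lerXn2r ?nnegrE // (le_trans _ qK).
  (* The factor [u] makes the left-hand side of the equation appear; its term u f' turns the - u
     f'^2 coming from the derivative of 1 - u into + u f'^2. *)
  rewrite -(pmulr_rge0 _ u0).
  have -> : u * (dE u + C * E u) = u * f1 u ^+ 2 + 2 * (q + u) * (f u * f1 u)
     + (u * C - 2 * al) * ((1 - u) * f1 u ^+ 2) + u * C * f u ^+ 2.
    rewrite /dE /E /= !fctE.
    have -> : u * (- f1 u ^+ 2 + (1 - u) * (2 * f1 u * f2 u) + 2 * f u * f1 u +
        C * ((1 - u) * (f1 u * f1 u) + f u * f u)) =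
       - u * f1 u ^+ 2 + 2 * f1 u * (u * (1 - u) * f2 u) + u * 2 * f u * f1 u +
       u * C * ((1 - u) * f1 u ^+ 2 + f u ^+ 2) by ring.
    by rewrite odeu; ring.
  have h1 : 0 <= u * C - 2 * al.
    rewrite /C mulrDr -addrA addrCA addr_ge0 //.
      by rewrite mulr_ge0 ?divr_ge0 ?sqr_ge0 // ltW.
    rewrite subr_ge0 mulrCA ler_peMr ?mulr_ge0 //.
    by rewrite ler_pdivlMr // mul1r ltW.
  have h2 : (q + u) ^+ 2 <= u * (u * C).
    apply: (le_trans q2); rewrite mulrA -expr2 /C mulrDr ler_wpDl //.
      by rewrite !mulr_ge0 ?sqr_ge0 ?invr_ge0 // ltW.
    rewrite mulrCA ler_peMr ?sqr_ge0 // ler_pdivlMr ?exprn_gt0 // mul1r.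
    by rewrite ler_sqr ?nnegrE ltW.
  have h3 : 0 <= (u * C - 2 * al) * ((1 - u) * f1 u ^+ 2).
    by rewrite mulr_ge0 // mulr_ge0 ?sqr_ge0 // subr_ge0 ltW.
  (* A second factor [u] allows completing the square u f' + (q + u) f; the remainders are
     nonnegative by the choice of [C]. *)
  rewrite -(pmulr_rge0 _ u0).
  have -> : u * (u * f1 u ^+ 2 + 2 * (q + u) * (f u * f1 u) +
      (u * C - 2 * al) * ((1 - u) * f1 u ^+ 2) + u * C * f u ^+ 2) =
      (u * f1 u + (q + u) * f u) ^+ 2 + (u * (u * C) - (q + u) ^+ 2) * f u ^+ 2
      + u * ((u * C - 2 * al) * ((1 - u) * f1 u ^+ 2)) by ring.
  apply: addr_ge0; last by rewrite mulr_ge0 // ltW.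
  apply: addr_ge0; first exact: sqr_ge0.
  by apply: mulr_ge0; [rewrite subr_ge0|exact: sqr_ge0].
have cH : {within `[t, 1], continuous H}.
  apply: derivable_within_continuous => u _; exact: (@ex_derive _ _ _ _ _ _ _ (dH u)).
have := ger0_derive1_ndecr (fun u _ => @ex_derive _ _ _ _ _ _ _ (dH u)) dH0 cH
  (lexx t) t1 (lexx 1).
rewrite /H /E !fctE /= subrr mul0r add0r f_1 !mulr0 mul0r.
rewrite pmulr_lle0 ?expR_gt0 // => le0.
have h : 0 <= (1 - t) * (f1 t * f1 t).
  by rewrite mulr_ge0 ?subr_ge0 // -expr2 sqr_ge0.
apply/eqP; rewrite -sqrf_eq0 eq_le sqr_ge0 andbT expr2; lra.
Qed.

(** The constant in the energy estimate blows up as t tends to 0, so the value at 0 is obtained by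
    continuity. *)
Lemma singular_ode_eq0 t : 0 <= t <= 1 -> f t = 0.
Proof.
move=> /andP[t0 t1]; have [tgt0|] := ltP 0 t; first exact: singular_ode_eq0_pos.
move=> tle0; have -> : t = 0 by apply/eqP; rewrite eq_le tle0.
have cf : f x @[x --> 0] --> f 0.
  exact/differentiable_continuous/derivable1_diffP/(@ex_derive _ _ _ _ _ _ _ (df 0)).
apply/eqP/negPn/negP => f0.
have : 0 < `|f 0| by rewrite normr_gt0.
move/cvgrPdist_lt : cf => /[apply] -[e /= e0 fe].
pose u := Num.min (e / 2) (1 / 2).
have u0 : 0 < u by rewrite lt_min; apply/andP; split; lra.
have ue : u <= e / 2 by rewrite ge_min lexx.
have u1 : u <= 1 / 2 by rewrite ge_min lexx orbT.
have := fe u; rewrite /= sub0r normrN (gtr0_norm u0) (singular_ode_eq0_pos u0); last lra.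
have ue' : u < e by lra.
by rewrite subr0 ltxx => /(_ ue').
Qed.

End SingularOde.

(** * The equations satisfied by even and odd profiles *)

Section RadialEquations.
Variables (R : realType) (m k : nat) (Y : 'rV[R]_m -> clifford R m).
Hypothesis mY : monogenic k Y.
Implicit Types t u : R.
Hypothesis m_gt0 : (0 < m)%N.
Variables (x0 : 'rV[R]_m).
Hypothesis Yx0 : Y x0 != 0.
Variables (c chi : R).
Local Notation s := ((m + 2 * k)%:R : R).
Local Notation D := (@derive1 R R).

Lemma smooth_is_derive (P : R -> R) n (t : R) : smooth P ->
  is_derive t 1 (derive1n n P) (derive1n n.+1 P t).
Proof.
move=> sP; rewrite /derive1n iterS derive1E; apply: derivableP; exact: sP.
Qed.

(** By homogeneity a nonzero value at one point other than the origin spreads to every radius. This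
    is what allows [Y] to be cancelled from the eigenvalue equation for each t > 0. *)
Lemma monogenic_sphere_neq0 t : 0 < t -> exists2 x, dot x x = t & Y x != 0.
Proof.
move=> t0; have [x xneq0 Yx] : exists2 x, 0 < dot x x & Y x != 0.
  have [|x00] := ltP 0 (dot x0 x0); first by exists x0.
  have x0E : x0 = 0.
    apply/rowP => j; have := coord_le_enorm x0 j; rewrite mxE /enorm.
    by rewrite (_ : dot x0 x0 = 0) ?sqrtr0 ?normr_le0 => [/eqP|] //; apply/eqP;
      rewrite eq_le x00 dot_ge0.
  (* If only the origin is known to carry a nonzero value, then Y(0) = 0^k Y(y) shows that Y(y) is
     nonzero as well. *)
  pose y : 'rV[R]_m := delta_mx 0 (Ordinal m_gt0).
  exists y; first by rewrite dot_delta mxE !eqxx.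
  have := monogenicZ mY 0 y; rewrite scale0r -x0E => e.
  by apply: contraNneq Yx0 => Yy; rewrite e Yy scaler0.
pose r := Num.sqrt (t / dot x x).
have r0 : 0 < r by rewrite sqrtr_gt0 divr_gt0.
exists (r *: x).
  by rewrite dotZr dotZl mulrA -expr2 sqr_sqrtr ?divfK ?gt_eqF // ltW // divr_gt0.
by rewrite (monogenicZ mY) scaler_eq0 negb_or expf_neq0 ?gt_eqF.
Qed.

(** The inner factor (1 - |x|^2) D (P Y) is the odd mode with profile A = 2 (1 - t) P', and D sends
    it to - (2 t A' + s A) Y; then Y(x) is cancelled at a point with |x|^2 = t. *)
Lemma even_ode P : smooth P ->
  (forall x, cball 1 x -> prolate_op c (even_mode Y P) x = chi *: even_mode Y P x) ->
  forall t, 0 < t -> t <= 1 ->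
  - (2 * t * (- (2 * D P t) + (1 - t) * (2 * D (D P) t)) + s * ((1 - t) * (2 * D P t)))
  + 4 * pi ^+ 2 * c ^+ 2 * t * P t = chi * P t.
Proof.
move=> sP eig t t0 t1; have [x xt Yx] := monogenic_sphere_neq0 t0.
have /eig : cball 1 x by rewrite /cball /= enorm_leE // xt expr1n.
have dP (u : R) := @smooth_is_derive P 0 u sP; have dP1 (u : R) :=
  @smooth_is_derive P 1 u sP.
have dA (u : R) : is_derive u 1 (fun t => (1 - t) * (2 * D P t)) (- (2 * D P u) +
  (1 - u) * (2 * D (D P) u)).
  rewrite (_ : (fun t => _) = (cst 1 - id) * (2 \*: D P)) //.
  by apply: is_derive_eq; rewrite /GRing.scale /= !fctE /= /GRing.scale /=; ring.
rewrite /prolate_op (dirac_even_mode mY); last by move=> u;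
  exact: (@ex_derive _ _ _ _ _ _ _ (dP u)).
rewrite (_ : (fun y => _) = odd_mode Y (fun t => (1 - t) * (2 * D P t))); last first.
  by apply/funext => y; rewrite !odd_modeE enorm_sqr scalerA.
rewrite (dirac_odd_mode mY); last by move=> u; exact: (@ex_derive _ _ _ _ _ _ _ (dA u)).
rewrite !even_modeE enorm_sqr xt derive1E (@derive_val _ _ _ _ _ _ _ (dA t))
  !scalerA -scalerDl.
by move/eqP; rewrite -subr_eq0 -scalerBl scaler_eq0 (negbTE Yx) orbF subr_eq0 => /eqP.
Qed.

(** Here the inner factor is the even mode with profile [C] and D doubles its derivative. The
    cancelled value x Y(x) is nonzero because x (x Y) = - t Y. *)
Lemma odd_ode Q : smooth Q ->
  (forall x, cball 1 x -> prolate_op c (odd_mode Y Q) x = chi *: odd_mode Y Q x) ->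
  forall t, 0 < t -> t <= 1 ->
  2 * ((2 * t * D Q t + s * Q t) - (1 - t) * ((2 + s) * D Q t + 2 * t * D (D Q) t))
  + 4 * pi ^+ 2 * c ^+ 2 * t * Q t = chi * Q t.
Proof.
move=> sQ eig t t0 t1; have [x xt Yx] := monogenic_sphere_neq0 t0.
have xYx : clvec x * Y x != 0.
  apply: contraNneq Yx => e; have := clvec_clvec x (Y x).
  rewrite e mulr0 xt => /esym/eqP; rewrite scaler_eq0 oppr_eq0 gt_eqF //.
have /eig : cball 1 x by rewrite /cball /= enorm_leE // xt expr1n.
have dQ (u : R) := @smooth_is_derive Q 0 u sQ; have dQ1 (u : R) :=
  @smooth_is_derive Q 1 u sQ.
pose C := fun t => - ((1 - t) * (2 * t * D Q t + s * Q t)).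
have dC (u : R) : is_derive u 1 C ((2 * u * D Q u + s * Q u) - (1 - u) * ((2 + s)
  * D Q u + 2 * u * D (D Q) u)).
  rewrite (_ : C = - ((cst 1 - id) * ((2 \*: id) * D Q + s \*: Q))) //.
  by apply: is_derive_eq; rewrite /GRing.scale /= !fctE /= /GRing.scale /=; ring.
rewrite /prolate_op (dirac_odd_mode mY); last by move=> u;
  exact: (@ex_derive _ _ _ _ _ _ _ (dQ u)).
rewrite (_ : (fun y => _) = even_mode Y C); last first.
  by apply/funext => y; rewrite !even_modeE enorm_sqr scalerA /C mulrN.
rewrite (dirac_even_mode mY); last by move=> u; exact: (@ex_derive _ _ _ _ _ _ _ (dC u)).
rewrite !odd_modeE enorm_sqr xt derive1E (@derive_val _ _ _ _ _ _ _ (dC t))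
  !scalerA -scalerDl.
by move/eqP; rewrite -subr_eq0 -scalerBl scaler_eq0 (negbTE xYx) orbF subr_eq0 => /eqP.
Qed.

End RadialEquations.

(** * The divergence identity *)

Lemma sqr_lt2 (R : realType) (r : R) : 0 < r -> r < 2 -> r ^+ 2 <= 4.
Proof. by move=> r0 r2; rewrite expr2; nra. Qed.

Lemma mul_lt2 (R : realType) (r d : R) : 0 < r -> r < 2 -> 0 <= d -> d <= 1 -> 2
  * r * d <= 4.
Proof. by move=> r0 r2 d0 d1; nra. Qed.

Lemma one_sub_sqr (R : realType) (r d : R) : r ^+ 2 <= d -> 1 - d <= 2 * (1 - r).
Proof. by move=> rd; have := sqr_ge0 (1 - r); nra. Qed.

Section RadialFunctional.
Variables (R : realType) (m k : nat) (H : 'rV[R]_m -> R).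
Local Notation T := (m.-tuple (measurableTypeR R)).
Local Notation mu := (tuple_lebesgue R m).
Local Notation row := (@row_of_tuple R m).
Local Notation s := ((m + 2 * k)%:R : R).
Local Notation D := (@derive1 R R).
Hypothesis mH : emeas H.
Variable M : R.
Hypothesis HM : forall x, cball 1 x -> `|H x| <= M.
Hypothesis HZ : forall (r : R) x, H (r *: x) = r ^+ (2 * k) * H x.
Implicit Types (G : R -> R) (r u : R).

Let M_ge0 : 0 <= M.
Proof.
apply: le_trans (HM (x := 0) _) => //.
by rewrite /cball /= enorm_leE // expr1n -[X in dot X _](scale0r (0 : 'rV[R]_m))
  dotZl mul0r.
Qed.

Definition radial_int G := eint (cball 1) (fun x => G (dot x x) * H x).

Lemma ebmeas_radial G : continuous G ->
  ebmeas (cball 1) (fun x => G (dot x x) * H x).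
Proof.
move=> cG; have [N N0 GN] := continuous_itv01_bounded cG.
have bG : ebmeas (cball 1) (fun x : 'rV[R]_m => G (dot x x)).
  apply: (@ebmeasW _ _ _ _ N); first exact: measurable_cball.
    by apply: (emeas_comp cG); exact: emeas_dotxx.
  by move=> x x1; apply: GN; exact: cball_dot_itv.
have bH : ebmeas (cball 1) H.
  by apply: (@ebmeasW _ _ _ _ M) => //; exact: measurable_cball.
exact: bmeasM.
Qed.

Lemma radial_intD G1 G2 : continuous G1 -> continuous G2 ->
  radial_int (fun t => G1 t + G2 t) = radial_int G1 + radial_int G2.
Proof.
move=> c1 c2; rewrite /radial_int -[RHS]RintegralD.
- by apply: eq_Rintegral => t _; rewrite mulrDl.
- exact: measurable_cball.
- by have := ebmeas_integrable (ebmeas_radial c1).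
- by have := ebmeas_integrable (ebmeas_radial c2).
Qed.

Lemma radial_intZ a G : continuous G ->
  radial_int (fun t => a * G t) = a * radial_int G.
Proof.
move=> c1; rewrite /radial_int -[RHS]RintegralZl.
- by apply: eq_Rintegral => t _; rewrite mulrA.
- exact: measurable_cball.
- by have := ebmeas_integrable (ebmeas_radial c1).
Qed.

(** The integral of G(|x|^2) H over the ball of radius r, transported to the unit ball and stripped
    of the homogeneity factor r^(m + 2 k). *)
Let dilated G r := radial_int (fun t => G (r ^+ 2 * t)).

Let dilatedE G r : continuous G -> 0 < r -> r <= 1 ->
  r ^+ (m + 2 * k) * dilated G r = eint (cball r) (fun x => G (dot x x) * H x).
Proof.
move=> cG r0 r1; rewrite [RHS](eint_dilate r0); last first.
  have [mf [N fN]] := ebmeas_radial cG; split.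
    apply: measurable_funS mf; first exact: measurable_cball.
    by move=> t /= tr; exact: le_trans tr r1.
  by exists N => t tr; apply: fN; exact: le_trans tr r1.
rewrite exprD -mulrA; congr (_ * _).
rewrite /dilated -radial_intZ; last first.
  by move=> t; apply: continuous_comp; [exact: mulrl_continuous|exact: cG].
apply: eq_Rintegral => t _ /=; rewrite HZ dotZr dotZl !mulrA -expr2.
by congr (_ * _); rewrite mulrC.
Qed.

Lemma is_derive_dilated G : (forall t : R, derivable G t 1) -> continuous (D G) ->
  is_derive (1 : R) 1 (dilated G) (radial_int (fun t => 2 * t * D G t)).
Proof.
move=> dG cDG.
have cG : continuous G.
  by move=> t; apply/differentiable_continuous/derivable1_diffP/dG.
pose f (r : R) (t : T) := G (r ^+ 2 * dot (row t) (row t)) * H (row t).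
(* The radius r ranges over ]0, 2[ around 1, so r^2 |x|^2 reaches up to 4: the derivative of [G]
   must be bounded on [0, 4], that is, after rescaling, on [0, 1]. *)
have cDG4 : continuous (fun t : R => D G (4 * t)).
  by move=> t; apply: continuous_comp; [exact: mulrl_continuous|exact: cDG].
have [N N0 GN] := continuous_itv01_bounded cDG4.
have I1 : `]0, 2[%classic (1 : R) by rewrite /= in_itv /=; lra.
have M0 := M_ge0.
have df r (t : T) : is_derive r 1 (f ^~ t) (D G (r ^+ 2 * dot (row t) (row t)) *
  (2 * r * dot (row t) (row t)) * H (row t)).
  have dl : is_derive r 1 (fun r : R => r ^+ 2 * dot (row t) (row t)) (2 * r *
    dot (row t) (row t)).
    rewrite (_ : (fun r => _) = dot (row t) (row t) \*: (id * id : R -> R)); last first.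
      by apply/funext => u; rewrite /GRing.scale /= mulrC.
    by apply: is_derive_eq; rewrite /GRing.scale /=; ring.
  have dGl : is_derive r 1 (G \o (fun r : R => r ^+ 2 * dot (row t) (row t)))
     (D G (r ^+ 2 * dot (row t) (row t)) * (2 * r * dot (row t) (row t))).
    by apply: (is_derive1_comp _ dl); rewrite derive1E; exact: derivableP.
  rewrite (_ : f ^~ t = H (row t) \*: (G \o (fun r : R => r ^+ 2 * dot (row t)
    (row t)))); last first.
    by apply/funext => u; rewrite /f /GRing.scale /= mulrC.
  rewrite [X in is_derive _ _ _ X]mulrC; exact: is_deriveZ.
have cGr r : continuous (fun t : R => G (r ^+ 2 * t)).
  by move=> t; apply: continuous_comp; [exact: mulrl_continuous|exact: cG].
have intf r : `]0, 2[%classic r -> mu.-integrable (row @^-1` cball 1) (EFin \o f r).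
  by move=> _; have := ebmeas_integrable (ebmeas_radial (cGr r)).
have iC : mu.-integrable (row @^-1` cball 1) (EFin \o (fun _ : T => N * 4 * M)).
  apply: (bmeas_integrable (@measurable_cball R m 1) (@cball_lty R m 1)).
  exact: bmeas_cst.
have Cge0 (t : T) : 0 <= N * 4 * M by rewrite !mulr_ge0.
have Gub r (t : T) : `]0, 2[%classic r -> (row @^-1` cball 1) t -> `|partial1of2
  f r t| <= N * 4 * M.
  rewrite /= in_itv /= => /andP[r0 r2] t1.
  rewrite /partial1of2 derive1E (@derive_val _ _ _ _ _ _ _ (df r t)).
  have /andP[d0 d1] := cball_dot_itv t1.
  rewrite normrM ler_pM //; last exact: HM.
  rewrite normrM ler_pM //.
    rewrite (_ : r ^+ 2 * _ = 4 * (r ^+ 2 / 4 * dot (row t) (row t))); last by field.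
    have q0 : 0 <= r ^+ 2 / 4 by rewrite divr_ge0 ?sqr_ge0.
    have q1 : r ^+ 2 / 4 <= 1 by rewrite ler_pdivrMr // mul1r; exact: (sqr_lt2 r0 r2).
    by apply: GN; rewrite mulr_ge0 //= mulr_ile1.
  have e0 : 0 <= 2 * r * dot (row t) (row t) by rewrite !mulr_ge0 // ltW.
  by rewrite (ger0_norm e0) mul_lt2.
have der := @derivable_under_integral R _ T mu f _ (@measurable_cball R m 1) 1 0 2 I1
  intf (fun r t _ _ => @ex_derive _ _ _ _ _ _ _ (df r t)) _ Cge0 iC Gub.
have dif := @differentiation_under_integral R _ T mu f _ (@measurable_cball R m
  1) 1 0 2 I1
  intf (fun r t _ _ => @ex_derive _ _ _ _ _ _ _ (df r t)) _ Cge0 iC Gub.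
apply: DeriveDef; first exact: der.
rewrite -derive1E [LHS]dif; apply: eq_Rintegral => t _.
rewrite /partial1of2 derive1E (@derive_val _ _ _ _ _ _ _ (df 1 t)).
by rewrite expr1n mul1r mulr1; ring.
Qed.

(* Phi r below is the integral of G(|x|^2) H over the ball of radius r.  Its
   derivative at 1 is the left-hand side by homogeneity, and it vanishes because
   the integral over the annulus r < |x| <= 1 is O((1 - r)^2) when G(1) = 0. *)
Lemma radial_int_div0 G : (forall t : R, derivable G t 1) -> continuous (D G) ->
  G 1 = 0 -> radial_int (fun t => 2 * t * D G t + s * G t) = 0.
Proof.
move=> dG cDG G10.
have cG : continuous G.
  by move=> t; apply/differentiable_continuous/derivable1_diffP/dG.
have [L L0 GL] := continuous_itv01_bounded cDG.
pose Phi r := r ^+ (m + 2 * k) * dilated G r.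
have c2 : continuous (fun t : R => 2 * t * D G t).
  move=> t; apply: cvgM; last exact: cDG.
  exact: mulrl_continuous.
have dPhi : is_derive (1 : R) 1 Phi (radial_int (fun t => 2 * t * D G t + s * G t)).
  have := is_derive_dilated dG cDG => dd.
  rewrite (_ : Phi = (id ^+ (m + 2 * k) : R -> R) * dilated G); last first.
    by apply/funext => r; rewrite /Phi /= fctE exprfctE.
  apply: is_derive_eq; rewrite exprfctE !expr1n scale1r.
  rewrite (@radial_intD (fun t => 2 * t * D G t) (fun t => s * G t)) //.
    congr (_ + _); rewrite radial_intZ // /GRing.scale /= mulr1 mulr1 mulrC;
      congr (_ * _).
    by congr (radial_int _); apply/funext => t; rewrite expr1n mul1r.
  by move=> t; apply: continuous_comp; [exact: cG|exact: mulrl_continuous].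
(* On the annulus |G| <= L (1 - |x|^2) <= 2 L (1 - r) and |H| <= M, while its volume is at most m (1
   - r) times that of the ball. *)
pose K := L * 2 * M * (m%:R * ball_volume R m).
have M0 := M_ge0; have V0 := ball_volume_ge0 R m.
have K0 : 0 <= K by rewrite !mulr_ge0.
have Glip t : 0 <= t <= 1 -> `|G t| <= L * (1 - t).
  move=> /andP[t0 t1].
  have dGu (u : R) : is_derive u 1 G (D G u) by rewrite derive1E; exact: derivableP.
  have [v] := MVT_segment t1 (fun u _ => dGu u) (continuous_subspaceT cG).
  rewrite in_itv /= G10 sub0r => /andP[tv v1] e; rewrite -normrN e normrM.
  rewrite [X in _ * X <= _]ger0_norm ?subr_ge0 // ler_wpM2r ?subr_ge0 //.
  by apply: GL; rewrite v1 (le_trans t0 tv).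
have bound r : 0 < r -> r < 1 -> `|Phi r - Phi 1| <= K * (1 - r) ^+ 2.
  move=> r0 r1.
  have bh := ebmeas_radial cG.
  have mr := @measurable_cball R m r; have m1 := @measurable_cball R m 1.
  have mann : measurable (row @^-1` (cball 1 `\` cball r)) by apply: measurableD.
  have rle1 : cball r `<=` (cball 1 : set 'rV[R]_m).
    by move=> x xr; apply: le_trans xr _; exact: ltW.
  have e1 : row @^-1` cball 1 = (row @^-1` cball r) `|` (row @^-1` (cball 1 `\` cball r)).
    apply/seteqP; split => t /=; last by case=> [/rle1|[]].
    by case: (pselect (cball r (row t))) => ?; [left|right].
  rewrite /Phi (dilatedE cG r0 (ltW r1)) (dilatedE cG ltr01 (lexx 1)) distrC.
  have -> : eint (cball 1) (fun x => G (dot x x) * H x) =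
     eint (cball r) (fun x => G (dot x x) * H x) +
     eint (cball 1 `\` cball r) (fun x => G (dot x x) * H x).
    rewrite {1}/eint e1 Rintegral_setU //.
      by rewrite -e1; have := ebmeas_integrable bh.
    by apply/disj_setPRL => t [/= _].
  rewrite addrC addKr.
  have -> : K * (1 - r) ^+ 2 = (L * (2 * (1 - r)) * M) * (m%:R * (1 - r) *
    ball_volume R m).
    by rewrite /K; ring.
  have ann_lty : (mu (row @^-1` (cball 1%R `\` cball r)) < +oo)%E.
    by apply: le_lt_trans (@cball_lty R m 1); apply: le_measure; rewrite ?inE // => t [].
  apply: (@le_trans _ _ ((L * (2 * (1 - r)) * M) *
      fine (mu (row @^-1` (cball 1%R `\` cball r))))); last first.
    apply: ler_wpM2l; last exact: (annulus_volume m r0 (ltW r1)).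
    by rewrite !mulr_ge0 // subr_ge0 ltW.
  apply: Rintegral_le_bound => //.
    by apply: measurable_funS bh.1 => // t [].
  move=> t [/= t1 /negP]; rewrite -ltNge => rt.
  have /andP[d0 d1] := cball_dot_itv t1.
  rewrite normrM ler_pM //; last exact: HM.
  apply: le_trans (Glip _ _) _; first by rewrite d0.
  rewrite ler_wpM2l //.
  have : r ^+ 2 <= dot (row t) (row t).
    by rewrite -enorm_sqr ler_sqr ?nnegrE ?enorm_ge0 // ltW.
  exact: one_sub_sqr.
set d := radial_int _ in dPhi *.
have cv : h^-1 *: (Phi (h *: 1 + 1) - Phi 1) @[h --> (0 : R)^'] --> d.
  by rewrite -(@derive_val _ _ _ _ _ _ _ dPhi); exact: (@ex_derive _ _ _ _ _ _ _ dPhi).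
apply/eqP; rewrite -normr_le0; apply/ler_addgt0Pl => e e0; rewrite addr0.
have e20 : 0 < e / 2 by rewrite divr_gt0.
move/cvgrPdist_lt : cv => /(_ _ e20)[delta /= delta0 hdelta].
(* The quotient is evaluated at - h, that is at the radius 1 - h inside the ball, where [bound]
   applies; the three bounds ensure h < delta, 1 - h > 0 and K h <= e / 2. *)
pose h := Num.min (delta / 2) (Num.min (1 / 2) (e / 2 / (K + 1))).
have K1 : 0 < K + 1 by rewrite ltr_wpDl.
have h0 : 0 < h by rewrite !lt_min !divr_gt0.
have hd : h < delta.
  have : h <= delta / 2 by rewrite ge_min lexx.
  by move=> /le_lt_trans; apply; rewrite ltr_pdivrMr // ltr_pMr // ltr1n.
have h1 : h < 1.
  have : h <= 1 / 2 by rewrite !ge_min lexx orbT.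
  by move=> /le_lt_trans; apply; rewrite ltr_pdivrMr // mul1r ltr1n.
have hK : K * h <= e / 2.
  have : h <= e / 2 / (K + 1) by rewrite !ge_min lexx !orbT.
  rewrite ler_pdivlMr // => /(le_trans _); apply.
  by rewrite mulrC ler_wpM2l ?ltW // ltrDl.
have := hdelta (- h); rewrite /= sub0r opprK gtr0_norm // => /(_ hd).
rewrite oppr_eq0 gt_eqF // => /(_ isT) /ltW dh.
rewrite -(subrK ((- h)^-1 *: (Phi (- h *: 1 + 1) - Phi 1)) d).
apply: le_trans (ler_normD _ _) _; rewrite [e]splitr lerD //.
have hr0 : 0 < 1 - h by rewrite subr_gt0.
have hr1 : 1 - h < 1 by rewrite ltrBlDr ltrDl.
have := bound _ hr0 hr1; rewrite subKr => bh.
rewrite /GRing.scale /= mulr1 [- h + 1]addrC normrM normfV normrN (gtr0_norm h0).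
rewrite mulrC ler_pdivrMr //.
apply: (le_trans bh); rewrite expr2 mulrA; apply: ler_wpM2r => //; exact: ltW.
Qed.

(** Subtracting the constant G(1) leaves a function vanishing at 1; the constant itself contributes
    s G(1) times the integral of [H]. *)
Lemma radial_int_div G : (forall t : R, derivable G t 1) -> continuous (D G) ->
  radial_int (fun t => 2 * t * D G t + s * G t) = s * radial_int (cst 1) * G 1.
Proof.
move=> dG cDG.
have cG : continuous G.
  by move=> t; apply/differentiable_continuous/derivable1_diffP/dG.
pose G0 := G - cst (G 1).
have dG0 t : is_derive (t : R) 1 G0 (D G t).
  by rewrite -[D G t]subr0 derive1E; apply: is_deriveB; exact: derivableP.
have DG0 : D G0 = D G.
  by apply/funext => t; rewrite derive1E (@derive_val _ _ _ _ _ _ _ (dG0 t)).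
have dG0' (t : R) : derivable G0 t 1 by exact: (@ex_derive _ _ _ _ _ _ _ (dG0 t)).
have c2 : continuous (fun t : R => 2 * t * D G t).
  move=> t; apply: cvgM; last exact: cDG.
  exact: mulrl_continuous.
have cs : continuous (fun t : R => s * G0 t).
  move=> t; apply: continuous_comp; last exact: mulrl_continuous.
  exact/differentiable_continuous/derivable1_diffP.
have := radial_int_div0 dG0' _; rewrite DG0 => /(_ cDG).
have -> : (fun t => 2 * t * D G t + s * G t) =
  (fun t => (2 * t * D G t + s * G0 t) + (s * G 1) * cst 1 t).
  by apply/funext => t; rewrite /G0 /= !fctE; ring.
rewrite (@radial_intD (fun t => 2 * t * D G t + s * G0 t)
  (fun t => s * G 1 * cst 1 t)); last 2 first.
- by move=> t; exact: (cvgD (c2 t) (cs t)).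
- by move=> t; exact: (cvg_cst (s * G 1 * 1)).
rewrite radial_intZ; last by move=> t; exact: cvg_cst.
move=> ->; first by rewrite add0r mulrAC.
by rewrite /G0 fctE /= subrr.
Qed.

End RadialFunctional.

(** * Symmetry of the Dirac operator on eigenfunctions *)

Section CliffordWave.
Variables (R : realType) (m : nat).
Local Notation T := (m.-tuple (measurableTypeR R)).
Local Notation mu := (tuple_lebesgue R m).
Local Notation row := (@row_of_tuple R m).
Implicit Types (a b f g : 'rV[R]_m -> clifford R m) (x xi : 'rV[R]_m) (c : R).
Implicit Types (D : set 'rV[R]_m).

Definition clmeas D f := forall A, ebmeas D (fun x => f x A).

Lemma clmeasZ D (l : R) f : clmeas D f -> clmeas D (fun x => l *: f x).
Proof.
move=> mf A; apply: bmeas_eq (bmeasZ l (mf A)) => t _ /=.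
by rewrite ffunE.
Qed.

Lemma clmeasN D f : clmeas D f -> clmeas D (fun x => - f x).
Proof.
move=> mf A; apply: bmeas_eq (bmeasZ (-1) (mf A)) => t _ /=.
by rewrite ffunE mulN1r.
Qed.

Lemma clmeas_scale D (h : 'rV[R]_m -> R) f : ebmeas D h -> clmeas D f ->
  clmeas D (fun x => h x *: f x).
Proof.
move=> mh mf A; apply: bmeas_eq (bmeasM mh (mf A)) => t _ /=.
by rewrite ffunE.
Qed.

Lemma clmeas_sum D (I : Type) (s : seq I) (F : I -> 'rV[R]_m -> clifford R m) :
  (forall i, clmeas D (F i)) -> clmeas D (fun x => \sum_(i <- s) F i x).
Proof.
move=> mF A.
apply: bmeas_eq (@bmeas_sum _ _ _ _ _ s predT (fun i t => F i (row t) A) _) => [t _ /=|i].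
  by rewrite sum_ffunE.
exact: mF.
Qed.

Lemma clmeas_mull D (u : clifford R m) f : clmeas D f -> clmeas D (fun x => u * f x).
Proof.
move=> mf C.
apply: bmeas_eq (@bmeas_sum _ _ _ _ _ (index_enum _) predT
  (fun A t => (-1) ^+ clsign A (symdiff A C) * u A * f (row t) (symdiff A C)) _)
    => [t _ /=|A].
  by rewrite clmulE.
by apply: bmeasZ; exact: mf.
Qed.

Lemma ebmeas_coord c j : 0 <= c -> ebmeas (cball c) (fun xi : 'rV[R]_m => xi 0 j).
Proof.
move=> c0; apply: (@ebmeasW _ _ _ _ c); [exact: measurable_cball|exact: emeas_coord|].
by move=> x xc; apply: le_trans xc; exact: coord_le_enorm.
Qed.

Lemma clmeas_clvec_mul c f : 0 <= c -> clmeas (cball c) f ->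
  clmeas (cball c) (fun xi => clvec xi * f xi).
Proof.
move=> c0 mf.
have := @clmeas_sum (cball c) _ (index_enum _) (fun j xi => xi 0 j *: (clgen R j * f xi)).
rewrite (_ : (fun x => \sum_(i <- index_enum _) _) = fun xi => clvec xi * f xi);
  last first.
  by apply/funext => xi; rewrite /clvec mulr_suml; apply: eq_bigr => j _;
    rewrite clscaleAl.
apply=> j; apply: clmeas_scale; first exact: ebmeas_coord.
exact: clmeas_mull.
Qed.

Lemma ebmeas_cldot D f g : clmeas D f -> clmeas D g -> ebmeas D (fun x => cldot
  (f x) (g x)).
Proof.
move=> mf mg; apply: bmeas_sum => A; apply: bmeasM; [exact: mf|exact: mg].
Qed.

Definition clwave c a b x : clifford R m :=
  [ffun A => swave c (fun xi => a xi A) (fun xi => b xi A) x].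

Definition clcos f xi : clifford R m := [ffun A => cos_transform (fun x => f x A) xi].
Definition clsin f xi : clifford R m := [ffun A => sin_transform (fun x => f x A) xi].

Let iball c h : ebmeas (cball c) h -> mu.-integrable (row @^-1` cball c) (EFin \o
  (h \o row)).
Proof. exact: ebmeas_integrable. Qed.

(** Stated for arbitrary scalar coefficients so as to cover both left multiplication by a Clifford
    number, expanded in blades, and plain sums. *)
Lemma swave_lin (I : Type) (s : seq I) (q : I -> R) c (a b : I -> 'rV[R]_m -> R) x :
  (forall i, ebmeas (cball c) (a i)) -> (forall i, ebmeas (cball c) (b i)) ->
  swave c (fun xi => \sum_(i <- s) q i * a i xi) (fun xi => \sum_(i <- s) q i * b
    i xi) x =
  \sum_(i <- s) q i * swave c (a i) (b i) x.
Proof.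
move=> ma mb.
have mab i : ebmeas (cball c) (fun xi => cos (phase xi x) * a i xi + sin (phase
  xi x) * b i xi).
  exact: ebmeas_wave.
transitivity (\int[mu]_(t in row @^-1` cball c) (\sum_(i <- s) q i *
   (cos (phase (row t) x) * a i (row t) + sin (phase (row t) x) * b i (row t)))).
  apply: eq_Rintegral => t _ /=; rewrite !mulr_sumr -big_split.
  by apply: eq_bigr => i _ /=; ring.
rewrite Rintegral_sum.
- apply: eq_bigr => i _; rewrite RintegralZl //; first exact: measurable_cball.
  exact: iball (mab i).
- exact: measurable_cball.
- exact: cball_lty.
- by move=> i; apply: bmeasZ; exact: mab.
Qed.

Lemma clwave_mull c (u : clifford R m) a b x : clmeas (cball c) a -> clmeas (cball c) b ->
  u * clwave c a b x = clwave c (fun xi => u * a xi) (fun xi => u * b xi) x.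
Proof.
move=> ma mb; apply/ffunP => C; rewrite clmulE ffunE.
under eq_bigr do rewrite ffunE.
rewrite -(swave_lin _ (fun A => (-1) ^+ clsign A (symdiff A C) * u A) (a := fun A
  xi => a xi (symdiff A C)) (b := fun A xi => b xi (symdiff A C))) //.
by congr (swave _ _ _ _); apply/funext => xi; rewrite clmulE.
Qed.

Lemma clwave_sum c (a b : 'I_m -> 'rV[R]_m -> clifford R m) x :
  (forall j, clmeas (cball c) (a j)) -> (forall j, clmeas (cball c) (b j)) ->
  \sum_j clwave c (a j) (b j) x =
  clwave c (fun xi => \sum_j a j xi) (fun xi => \sum_j b j xi) x.
Proof.
move=> ma mb; apply/ffunP => C; rewrite sum_ffunE ffunE.
transitivity (\sum_j 1 * swave c (fun xi => a j xi C) (fun xi => b j xi C) x).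
  by apply: eq_bigr => j _; rewrite ffunE mul1r.
rewrite -(swave_lin _ (fun=> 1)) => [|j|j]; [|exact: ma|exact: mb].
by congr (swave _ _ _ _); apply/funext => xi; rewrite sum_ffunE;
  apply: eq_bigr => j _; rewrite mul1r.
Qed.

Lemma dirac_clwave c a b x : 0 <= c -> clmeas (cball c) a -> clmeas (cball c) b ->
  dirac (clwave c a b) x =
  clwave c (fun xi => (2 * pi) *: (clvec xi * b xi)) (fun xi => - ((2 * pi) *:
    (clvec xi * a xi))) x.
Proof.
move=> c0 ma mb.
have p j : partial j (clwave c a b) x =
    clwave c (fun xi => (2 * pi * xi 0 j) *: b xi) (fun xi => (- (2 * pi * xi 0
      j)) *: a xi) x.
  apply: partialE => A; rewrite ffunE.
  under [X in is_derive _ _ X _]eq_fun do rewrite ffunE.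
  have := is_derive_swave x (delta_mx 0 j) c0 (ma A) (mb A).
  move/is_derive_eq; apply; congr (swave _ _ _ _); apply/funext => xi;
    by rewrite ffunE /phase dot_delta /GRing.scale /= ?mulNr.
have mj j : ebmeas (cball c) (fun xi : 'rV[R]_m => 2 * pi * xi 0 j).
  by apply: bmeasZ; exact: ebmeas_coord.
have mNj j : ebmeas (cball c) (fun xi : 'rV[R]_m => - (2 * pi * xi 0 j)).
  apply: bmeas_eq (bmeasZ (-1) (mj j)) => t _ /=; exact: mulN1r.
rewrite /dirac; under eq_bigr => j _.
  rewrite p clwave_mull; [over|exact: clmeas_scale|exact: clmeas_scale].
rewrite clwave_sum; last 2 first.
- by move=> j; apply/clmeas_mull/clmeas_scale.
- by move=> j; apply/clmeas_mull/clmeas_scale.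
congr (clwave _ _ _ _); apply/funext => xi.
  rewrite /clvec mulr_suml scaler_sumr; apply: eq_bigr => j _.
  by rewrite -clscaleAr -clscaleAl scalerA.
rewrite /clvec mulr_suml scaler_sumr -sumrN; apply: eq_bigr => j _.
by rewrite -clscaleAr -clscaleAl scalerA scaleNr.
Qed.

Lemma clvec_mul2 (q l : R) xi (u : clifford R m) :
  q *: (clvec xi * (q *: (clvec xi * (l *: u)))) = - (q ^+ 2 * l * dot xi xi) *: u.
Proof.
rewrite -clscaleAr scalerA clvec_clvec !scalerA; congr (_ *: _); ring.
Qed.

Definition clip f g : R := eint (cball 1) (fun x => cldot (f x) (g x)).

Lemma clipC f g : clip f g = clip g f.
Proof. by apply: eq_Rintegral => t _; exact: cldotC. Qed.

Lemma clmeas_clwave c a b : clmeas (cball c) a -> clmeas (cball c) b ->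
  clmeas (cball 1) (clwave c a b).
Proof.
move=> ma mb A; apply: bmeas_eq (ebmeas_swave (ma A) (mb A)) => t _ /=.
by rewrite ffunE.
Qed.

Lemma clmeas_clcos c f : clmeas (cball 1) f -> clmeas (cball c) (clcos f).
Proof.
move=> mf A; apply: bmeas_eq (ebmeas_cos_transform c (mf A)) => t _ /=.
by rewrite ffunE.
Qed.

Lemma clmeas_clsin c f : clmeas (cball 1) f -> clmeas (cball c) (clsin f).
Proof.
move=> mf A; apply: bmeas_eq (ebmeas_sin_transform c (mf A)) => t _ /=.
by rewrite ffunE.
Qed.

Lemma clwave_pairing c a b g :
  clmeas (cball c) a -> clmeas (cball c) b -> clmeas (cball 1) g ->
  clip (clwave c a b) g =
  eint (cball c) (fun xi => cldot (a xi) (clcos g xi) + cldot (b xi) (clsin g xi)).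
Proof.
move=> ma mb mg; have mcos := clmeas_clcos c mg; have msin := clmeas_clsin c mg.
rewrite /clip /eint /cldot Rintegral_sum; last 3 first.
- exact: measurable_cball.
- exact: cball_lty.
- by move=> A; apply: bmeasM; [exact: clmeas_clwave|exact: mg].
transitivity (\sum_A eint (cball c) (fun xi => a xi A * clcos g xi A + b xi A *
  clsin g xi A)).
  apply: eq_bigr => A _; rewrite -[RHS](_ : eint (cball c) (fun xi =>
    a xi A * cos_transform (fun x => g x A) xi + b xi A * sin_transform (fun x =>
      g x A) xi) = _).
    rewrite -swave_pairing; [|exact: ma|exact: mb|exact: mg].
    by apply: eq_Rintegral => t _; rewrite ffunE.
  by apply: eq_Rintegral => t _; rewrite !ffunE.
rewrite -[RHS](_ : eint (cball c) (fun xi => \sum_A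
   (a xi A * clcos g xi A + b xi A * clsin g xi A)) = _); last first.
  by apply: eq_Rintegral => t _; rewrite big_split.
rewrite [RHS]Rintegral_sum //; first exact: measurable_cball.
- exact: cball_lty.
- move=> A; apply: bmeasD; apply: bmeasM; [exact: ma|exact: mcos|exact: mb|exact: msin].
Qed.

Lemma differentiable_dotxx x : differentiable (fun y : 'rV[R]_m => dot y y) x.
Proof.
rewrite /dot; elim: (index_enum _) => [|j r IHr].
  by under eq_fun do rewrite big_nil; exact: differentiable_cst.
under eq_fun do rewrite big_cons.
by apply: differentiableD => //; apply: differentiableM; exact: differentiable_coord.
Qed.

Lemma eq_dirac_open_ball f g : (forall x, enorm x < 1 -> f x = g x) ->
  forall x, enorm x < 1 -> dirac f x = dirac g x.
Proof.
move=> fg x x1; apply: eq_bigr => j _; congr (_ * _); apply/ffunP => A; rewrite !ffunE.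
apply: near_eq_derive; near=> y; rewrite fg // enorm_lt1E.
near: y; have := differentiable_continuous (differentiable_dotxx x).
by move/cvgr_lt; apply; rewrite -enorm_lt1E.
Unshelve. all: by end_near. Qed.

(** The real form of Q P_c f = lambda f, with [l] standing for lambda^-1. *)
Definition bandlimited c (l : R) f := [/\ clmeas (cball 1) f &
  forall x, cball 1 x -> f x = clwave c (fun xi => l *: clcos f xi) (fun xi => l
    *: clsin f xi) x].

Section Symmetry.
Variables (c l : R) (f g : 'rV[R]_m -> clifford R m).
Hypotheses (c0 : 0 <= c) (bf : bandlimited c l f) (bg : bandlimited c l g).

Let clip_dirac u v : bandlimited c l u -> bandlimited c l v ->
  clmeas (cball 1) (dirac u) ->
  clip (dirac u) v = eint (cball c) (fun xi =>
    2 * pi * l * (cldot (clvec xi * clsin u xi) (clcos v xi) -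
                  cldot (clvec xi * clcos u xi) (clsin v xi))).
Proof.
move=> [mu_ eu] [mv _] mdu.
have mc := clmeas_clcos c mu_; have ms := clmeas_clsin c mu_.
pose a xi := (2 * pi) *: (clvec xi * (l *: clsin u xi)).
pose b xi := - ((2 * pi) *: (clvec xi * (l *: clcos u xi))).
have ma : clmeas (cball c) a by apply/clmeasZ/clmeas_clvec_mul/clmeasZ.
have mb : clmeas (cball c) b by apply/clmeasN/clmeasZ/clmeas_clvec_mul/clmeasZ.
pose W := clwave c (fun xi => l *: clcos u xi) (fun xi => l *: clsin u xi).
have eW : dirac W = clwave c a b.
  by apply/funext => x; apply: dirac_clwave => //; exact: clmeasZ.
rewrite /clip (eq_eint_open_ball (g := fun x => cldot (clwave c a b x) (v x)));
  last 3 first.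
- exact: ebmeas_cldot.
- by apply: ebmeas_cldot => //; exact: clmeas_clwave ma mb.
- move=> x x1; congr (cldot _ _); rewrite -eW.
  by apply: eq_dirac_open_ball x1 => y y1; apply: eu; exact: ltW.
rewrite -/(clip _ _) clwave_pairing //; apply: eq_Rintegral => t _ /=.
rewrite /a /b cldotNl !cldotZl -!clscaleAr !cldotZl; ring.
Qed.

(** Skewness of left multiplication by xi and the opposite signs of the two mixed terms compensate
    each other: each term of one side is one of the other. The factor [l] has to be the same for
    both functions. *)
Lemma clip_dirac_sym : clmeas (cball 1) (dirac f) -> clmeas (cball 1) (dirac g) ->
  clip (dirac f) g = clip f (dirac g).
Proof.
move=> mf mg; rewrite [RHS]clipC (clip_dirac bf bg mf) (clip_dirac bg bf mg).
apply: eq_Rintegral => t _ /=; congr (_ * _).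
rewrite (cldot_clvec _ (clsin f (row t))) (cldot_clvec _ (clcos f (row t))).
rewrite opprK addrC (cldotC (clcos f (row t))) (cldotC (clsin f (row t))); reflexivity.
Qed.

(** Two multiplications by xi give the scalar - |xi|^2, so the result is visibly symmetric in [u]
    and [v]; the minus sign cancels against that of the second derivative of cos and sin. *)
Let clip_dirac2 u v : bandlimited c l u -> bandlimited c l v ->
  clmeas (cball 1) (dirac (dirac u)) ->
  clip (dirac (dirac u)) v = eint (cball c) (fun xi =>
    (2 * pi) ^+ 2 * l * dot xi xi * (cldot (clcos u xi) (clcos v xi) +
                  cldot (clsin u xi) (clsin v xi))).
Proof.
move=> [mu_ eu] [mv _] mdu.
have mc := clmeas_clcos c mu_; have ms := clmeas_clsin c mu_.
pose a xi := (2 * pi) *: (clvec xi * (l *: clsin u xi)).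
pose b xi := - ((2 * pi) *: (clvec xi * (l *: clcos u xi))).
have ma : clmeas (cball c) a by apply/clmeasZ/clmeas_clvec_mul/clmeasZ.
have mb : clmeas (cball c) b by apply/clmeasN/clmeasZ/clmeas_clvec_mul/clmeasZ.
pose W := clwave c (fun xi => l *: clcos u xi) (fun xi => l *: clsin u xi).
have eW : dirac W = clwave c a b.
  by apply/funext => x; apply: dirac_clwave => //; exact: clmeasZ.
pose a2 xi := (2 * pi) *: (clvec xi * b xi).
pose b2 xi := - ((2 * pi) *: (clvec xi * a xi)).
have ma2 : clmeas (cball c) a2 by apply/clmeasZ/clmeas_clvec_mul.
have mb2 : clmeas (cball c) b2 by apply/clmeasN/clmeasZ/clmeas_clvec_mul.
have eW2 : dirac (clwave c a b) = clwave c a2 b2.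
  by apply/funext => x; exact: dirac_clwave.
rewrite /clip (eq_eint_open_ball (g := fun x => cldot (clwave c a2 b2 x) (v x)));
  last 3 first.
- exact: ebmeas_cldot.
- by apply: ebmeas_cldot => //; exact: clmeas_clwave ma2 mb2.
- move=> x x1; congr (cldot _ _); rewrite -eW2 -eW.
  apply: eq_dirac_open_ball x1 => y y1.
  by apply: eq_dirac_open_ball y1 => z z1; apply: eu; exact: ltW.
rewrite -/(clip _ _) clwave_pairing //; apply: eq_Rintegral => t _ /=.
rewrite /a2 /b2 /a /b mulrN scalerN !clvec_mul2 !cldotNl !cldotZl.
by ring.
Qed.

Lemma clip_dirac2_sym : clmeas (cball 1) (dirac (dirac f)) ->
  clmeas (cball 1) (dirac (dirac g)) ->
  clip (dirac (dirac f)) g = clip f (dirac (dirac g)).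
Proof.
move=> mf mg; apply: (etrans (clip_dirac2 bf bg mf)).
apply/esym/(etrans (clipC _ _))/(etrans (clip_dirac2 bg bf mg)).
congr (eint _ _); apply/funext => xi.
by rewrite (cldotC (clcos f xi)) (cldotC (clsin f xi)).
Qed.

End Symmetry.

End CliffordWave.

(** * Distinctness *)

Section Bandlimited.
Variables (R : realType) (m : nat).
Local Notation row := (@row_of_tuple R m).

Lemma eint_trunc (h : 'rV[R]_m -> R -> R) (f : 'rV[R]_m -> clifford R m) A :
  (forall x, h x 0 = 0) ->
  eint setT (fun x => h x (trunc f x A)) = eint (cball 1) (fun x => h x (f x A)).
Proof.
move=> h0; rewrite /eint preimage_setT [RHS]Rintegral_mkcond.
apply: eq_Rintegral => t _; rewrite /trunc patchE.
case: ifPn => t1; case: ifPn => // t2.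
- by move: t2; rewrite notin_setE => /(_ t1).
- by move: t2; rewrite inE /cball /= (negbTE t1).
- by rewrite ffunE.
Qed.

(** Since [f] is real, its Fourier transform has real part [clcos f] and imaginary part - [clsin f].
    Taking the real part of the equation on the ball and dividing by [l] gives the claim. *)
Lemma bandlimited_eigen c (l : R) (f : 'rV[R]_m -> clifford R m) : 0 < l ->
  clmeas (cball 1) f ->
  (forall x, trunc (bandlimit c (fun y => clcomplex (trunc f y))) x =
             l%:C%C *: clcomplex (trunc f x)) ->
  bandlimited c l^-1 f.
Proof.
move=> l0 mf eig; split=> // x x1; apply/ffunP => A; rewrite ffunE.
have cosE xi : complex.Re (fourier (fun y => clcomplex (trunc f y)) xi A) = clcos f xi A.
  rewrite !ffunE /= /cos_transform.
  rewrite -(@eint_trunc (fun x a => cos (phase xi x) * a)); last by move=> ?;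
    rewrite mulr0.
  apply: eq_Rintegral => t _; rewrite !ffunE /= mulr0 subr0 cosN dotC.
  by [].
have sinE xi : complex.Im (fourier (fun y => clcomplex (trunc f y)) xi A) = -
  clsin f xi A.
  rewrite !ffunE /= /sin_transform.
  transitivity (eint setT (fun x => -1 * (sin (phase xi x) * trunc f x A))).
    apply: eq_Rintegral => t _; rewrite !ffunE /= mulr0 add0r sinN dotC mulN1r mulNr.
    by [].
  rewrite (@eint_trunc (fun x a => -1 * (sin (phase xi x) * a)));
    last by move=> ?; rewrite !mulr0.
  rewrite /eint RintegralZl ?mulN1r //; first exact: measurable_cball.
  apply: (bmeas_integrable (@measurable_cball R m 1) (@cball_lty R m 1)).
  apply: bmeas_eq (ebmeas_wave xi (bmeas_cst _ 0 : ebmeas (cball 1) (cst 0)) (mf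
    A)) => t _ /=.
  by rewrite mulr0 add0r /phase dotC.
have mc := clmeas_clcos c mf; have ms := clmeas_clsin c mf.
have -> : swave c (fun xi => (l^-1 *: clcos f xi) A) (fun xi => (l^-1 *: clsin f
  xi) A) x =
   l^-1 * swave c (fun xi => clcos f xi A) (fun xi => clsin f xi A) x.
  rewrite /swave /eint -RintegralZl; last 2 first.
  - exact: measurable_cball.
  - exact: (ebmeas_integrable (ebmeas_wave x (mc A) (ms A))).
  apply: eq_Rintegral => t _; rewrite !(ffunE, mulrDr) /GRing.scale /=.
  by congr (_ + _); rewrite mulrCA.
apply: (@mulfI _ l); first by rewrite gt_eqF.
rewrite mulVKf ?gt_eqF //.
have := congr1 (fun u : clifford R[i] m => complex.Re (u A)) (eig x).
rewrite /trunc x1 !ffunE /= mul0r subr0 => <-.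
apply: eq_Rintegral => t _; rewrite ffunE.
have := cosE (row t); have := sinE (row t).
by case: (fourier _ _ _) => u v /= -> ->; rewrite mulrN opprK.
Qed.

End Bandlimited.

(** * Scalar products of even and odd modes *)

Section Modes.
Variables (R : realType) (m k : nat) (Y : 'rV[R]_m -> clifford R m).
Hypothesis mY : monogenic k Y.
Local Notation row := (@row_of_tuple R m).
Local Notation s := ((m + 2 * k)%:R : R).
Local Notation D := (@derive1 R R).
Implicit Types (F G P Q : R -> R).

Lemma emeas_monogenic A : emeas (fun x => Y x A).
Proof.
have [[a aY] _] := mY.
rewrite (_ : (fun x => _) = fun x : 'rV_m => \sum_(al : {ffun 'I_m -> 'I_k.+1} |
  (\sum_j al j == k)%N)
            (\prod_j x 0 j ^+ al j) * a al A); last first.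
  by apply/funext => y; rewrite aY sum_ffunE; apply: eq_bigr => al _; rewrite ffunE.
apply: emeas_sum => al; apply: emeasM; last exact: emeas_cst.
by apply: emeas_prod => j; apply: emeasX; exact: emeas_coord.
Qed.

Lemma ebmeas_monogenic A : ebmeas (cball 1) (fun x => Y x A).
Proof.
have [[a aY] _] := mY.
apply: (@ebmeasW _ _ _ _ (\sum_(al : {ffun 'I_m -> 'I_k.+1} | (\sum_j al j ==
  k)%N) `|a al A|)).
- exact: measurable_cball.
- exact: emeas_monogenic.
- move=> x x1; rewrite aY sum_ffunE (le_trans (ler_norm_sum _ _ _)) //.
  apply: ler_sum => al _; rewrite ffunE normrM ler_piMl // normr_prod.
  apply: prodr_ile1 => j _; rewrite normr_ge0 /= normrX exprn_ile1 //.
  exact: le_trans (coord_le_enorm _ _) x1.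
Qed.

Definition sqnorm x := clsqnorm (Y x).

Lemma emeas_sqnorm : emeas sqnorm.
Proof. by apply: emeas_sum => A; apply: emeasX; exact: emeas_monogenic. Qed.

Lemma sqnorm_bounded : exists M, forall x, cball 1 x -> `|sqnorm x| <= M.
Proof.
have : ebmeas (cball 1) (fun x => cldot (Y x) (Y x)).
  by apply: ebmeas_cldot => A; exact: ebmeas_monogenic.
move=> [_ [M YM]]; exists M => x x1; rewrite /sqnorm clsqnorm_cldot.
have e : row_of_tuple [tuple x 0 j | j < m] = x.
  by apply/rowP => j; rewrite mxE tnth_mktuple.
by have := YM [tuple x 0 j | j < m]; rewrite /= e; exact.
Qed.

Lemma sqnormZ (r : R) x : sqnorm (r *: x) = r ^+ (2 * k) * sqnorm x.
Proof.
by rewrite /sqnorm (monogenicZ mY) !clsqnorm_cldot cldotZl cldotZr mulrA -exprD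
  mul2n addnn.
Qed.

Lemma sqnorm_ge0 x : 0 <= sqnorm x.
Proof. by apply: sumr_ge0 => A _; rewrite sqr_ge0. Qed.

Definition mode (b : bool) F := if b then odd_mode Y F else even_mode Y F.

Lemma clmeas_mode b F : continuous F -> clmeas (cball 1) (mode b F).
Proof.
move=> cF; have [N N0 FN] := continuous_itv01_bounded cF.
have mF : ebmeas (cball 1) (fun x : 'rV[R]_m => F (dot x x)).
  apply: (@ebmeasW _ _ _ _ N); first exact: measurable_cball.
    by apply: (emeas_comp cF); exact: emeas_dotxx.
  by move=> x x1; apply: FN; exact: cball_dot_itv.
rewrite /mode; case: b; rewrite ?odd_modeE ?even_modeE; apply: clmeas_scale => //.
  by apply: clmeas_clvec_mul => // A; exact: ebmeas_monogenic.
by move=> A; exact: ebmeas_monogenic.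
Qed.

(** The factor |x|^2 for odd modes comes from |x Y|^2 = |x|^2 |Y|^2; it becomes the weight t in all
    radial integrals of odd modes. *)
Lemma cldot_mode b F G x : cldot (mode b F x) (mode b G x) =
  (if b then dot x x else 1) * (F (dot x x) * G (dot x x)) * sqnorm x.
Proof.
rewrite /sqnorm clsqnorm_cldot /mode; case: b; rewrite ?odd_modeE ?even_modeE.
  by rewrite cldotZl cldotZr cldot_clvec_clvec; ring.
by rewrite cldotZl cldotZr; ring.
Qed.

Lemma clip_mode b F G : clip (mode b F) (mode b G) =
  radial_int sqnorm (fun t => (if b then t else 1) * (F t * G t)).
Proof.
by apply: eq_Rintegral => t _; rewrite cldot_mode; case: b.
Qed.

Lemma dirac_mode b F : (forall t : R, derivable F t 1) ->
  dirac (mode b F) = mode (~~ b) (fun t =>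
    if b then - (2 * t * D F t + s * F t) else 2 * D F t).
Proof.
by case: b => dF /=; [exact: (dirac_odd_mode mY)|exact: (dirac_even_mode mY)].
Qed.

End Modes.

(** The quotient is the binomial coefficient of m + k - 2 over k. Its positivity provides a basis
    element to work with. *)
Lemma dim_monogenic_gt0 m k : (2 <= m)%N -> (0 < dim_monogenic m k)%N.
Proof.
move=> m2; rewrite /dim_monogenic divn_gt0 ?muln_gt0 ?fact_gt0 //.
rewrite -(@bin_fact (m + k - 2) k); last by lia.
have -> : (m + k - 2 - k = m - 2)%N by lia.
rewrite mulnC leq_pmull ?bin_gt0 //; lia.
Qed.

(** Solves for the second derivative in the shape required by the uniqueness result, with al = s /
    2; in the odd case al = (2 + s) / 2. *)
Lemma even_ode_normal (R : realType) (s q chi t p p1 p2 : R) :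
  - (2 * t * (- (2 * p1) + (1 - t) * (2 * p2)) + s * ((1 - t) * (2 * p1))) + q *
    t * p = chi * p ->
  t * (1 - t) * p2 = (t - s / 2 * (1 - t)) * p1 + (- chi / 4 + q / 4 * t) * p.
Proof. by move=> h; lra. Qed.

Lemma odd_ode_normal (R : realType) (s q chi t p p1 p2 : R) :
  2 * ((2 * t * p1 + s * p) - (1 - t) * ((2 + s) * p1 + 2 * t * p2)) + q * t * p
    = chi * p ->
  t * (1 - t) * p2 = (t - (2 + s) / 2 * (1 - t)) * p1 + (- (chi - 2 * s) / 4 + q
    / 4 * t) * p.
Proof. by move=> h; lra. Qed.

Section Distinct.
Variables (R : realType) (m k : nat) (c : R).
Variable (Y : 'rV[R]_m -> clifford R m).
Hypotheses (m_gt0 : (0 < m)%N) (mY : monogenic k Y).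
Local Notation s := ((m + 2 * k)%:R : R).
Local Notation D := (@derive1 R R).
Implicit Types (P : R -> R).

Lemma smooth_continuous P n : smooth P -> continuous (derive1n n P).
Proof.
move=> sP t; apply/differentiable_continuous/derivable1_diffP; exact: sP.
Qed.

Let W := radial_int (sqnorm Y).

(** On the ball the squared norm of a mode is at most N^2 |Y|^2, where N bounds the profile, so a
    mode of norm 1 excludes that the integral of |Y|^2 vanishes. *)
Lemma mode_normalised_gt0 b P : smooth P ->
  eint (cball 1) (fun x => clsqnorm (mode Y b P x)) = 1 -> 0 < W (cst 1).
Proof.
move=> sP; have cP := @smooth_continuous P 0 sP.
have [N N0 PN] := continuous_itv01_bounded cP.
have [M YM] := sqnorm_bounded mY.
have b1 : ebmeas (cball 1) (fun x => cst 1 (dot x x) * sqnorm Y x).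
  by apply: (ebmeas_radial (emeas_sqnorm mY) YM) => t; exact: cvg_cst.
have Yge0 := sqnorm_ge0 Y.
move=> e1; rewrite lt_neqAle Rintegral_ge0 ?andbT; last first.
  by move=> t _; rewrite /= mul1r.
apply/eqP => W0.
have mm := clmeas_mode mY b cP.
have : 1 <= N ^+ 2 * W (cst 1).
  rewrite -[X in X <= _]e1 /W /radial_int /eint -RintegralZl; last 2 first.
  - exact: measurable_cball.
  - exact: (ebmeas_integrable b1).
  apply: le_Rintegral.
  - exact: measurable_cball.
  - apply: (bmeas_integrable (@measurable_cball R m 1) (@cball_lty R m 1)).
    by apply: bmeas_eq (ebmeas_cldot mm mm) => t _ /=; rewrite clsqnorm_cldot.
  - by apply: (bmeas_integrable (@measurable_cball R m 1) (@cball_lty R m 1));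
    exact: bmeasZ.
  - move=> t t1 /=; rewrite clsqnorm_cldot cldot_mode mul1r ler_wpM2r //.
    have /andP[d0 d1] := cball_dot_itv t1.
    have : `|P (dot (row_of_tuple t) (row_of_tuple t))| <= N by apply: PN; rewrite d0.
    rewrite -expr2 => PN'.
    apply: (@le_trans _ _ (P (dot (row_of_tuple t) (row_of_tuple t)) ^+ 2)).
      by case: b {e1 mm}; rewrite ?mul1r // ler_piMl // sqr_ge0.
    by rewrite -(real_normK (num_real (P _))) lerXn2r ?nnegrE.
by rewrite -W0 mulr0 ler10.
Qed.

Lemma radial_div_eq0 G : 0 < W (cst 1) -> (forall t : R, derivable G t 1) ->
  continuous (D G) -> W (fun t => 2 * t * D G t + s * G t) = 0 -> G 1 = 0.
Proof.
move=> W0 dG cG; have [M YM] := sqnorm_bounded mY.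
have e := radial_int_div (emeas_sqnorm mY) YM (sqnormZ mY) dG cG.
move=> /(etrans (esym e))/eqP; rewrite -/(W _) !mulf_eq0 (gt_eqF W0) orbF
  pnatr_eq0 addn_eq0 (gtn_eqF m_gt0) /=.
by move/eqP.
Qed.

Lemma sqnorm_neq0 : 0 < W (cst 1) -> exists x, Y x != 0.
Proof.
move=> W0; apply: contrapT => /forallNP Y0; move: W0.
rewrite /W /radial_int (_ : (fun x => _) = cst 0); last first.
  apply/funext => x; have /negP := Y0 x; rewrite negbK => /eqP Yx.
  by rewrite /sqnorm Yx /clsqnorm big1 ?mulr0 // => A _; rewrite ffunE expr0n.
by rewrite /eint Rintegral_cst ?mul0r ?ltxx //; exact: measurable_cball.
Qed.

Let qc := 4 * pi ^+ 2 * c ^+ 2 : R.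

(* Evaluate the radial equation at t = 1, where its leading coefficient vanishes. *)
Lemma even_boundary chi P : 0 < W (cst 1) -> eigenprofile c (even_mode Y) chi P ->
  4 * D P 1 = (chi - qc) * P 1 /\ P 1 != 0.
Proof.
move=> W0 [sP [t t01 Pt] eig]; have [x0 Yx0] := sqnorm_neq0 W0.
have ode := even_ode mY m_gt0 Yx0 sP eig; split.
  by have := ode 1 ltr01 (lexx 1); rewrite -/qc => h; lra.
apply: contra_neq Pt => P1.
have al0 : 0 <= s / 2 by rewrite divr_ge0.
apply: (singular_ode_eq0 al0 (fun u => @smooth_is_derive R P 0 u sP) (fun u =>
  @smooth_is_derive R P 1 u sP) _ P1 t01).
by move=> u u0 u1; have := ode u u0 u1; rewrite -/qc => h; exact: (even_ode_normal h).
Qed.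

(** As in the even case; the shift - 2 s comes from the term 2 s Q, which the derivative of the
    factor 1 - t leaves behind at t = 1. *)
Lemma odd_boundary chi P : 0 < W (cst 1) -> eigenprofile c (odd_mode Y) chi P ->
  4 * D P 1 = (chi - qc - 2 * s) * P 1 /\ P 1 != 0.
Proof.
move=> W0 [sP [t t01 Pt] eig]; have [x0 Yx0] := sqnorm_neq0 W0.
have ode := odd_ode mY m_gt0 Yx0 sP eig; split.
  by have := ode 1 ltr01 (lexx 1); rewrite -/qc => h; lra.
apply: contra_neq Pt => P1.
have al0 : 0 <= (2 + s) / 2 by rewrite divr_ge0 // addr_ge0.
apply: (singular_ode_eq0 al0 (fun u => @smooth_is_derive R P 0 u sP) (fun u =>
  @smooth_is_derive R P 1 u sP) _ P1 t01).
by move=> u u0 u1; have := ode u u0 u1; rewrite -/qc => h; exact: (odd_ode_normal h).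
Qed.

Let continuousM_ (f g : R -> R) : continuous f -> continuous g ->
  continuous (fun t : R => f t * g t).
Proof. by move=> cf cg t; apply: cvgM; [exact: cf|exact: cg]. Qed.

Let continuousD_ (f g : R -> R) : continuous f -> continuous g ->
  continuous (fun t : R => f t + g t).
Proof. by move=> cf cg t; apply: cvgD; [exact: cf|exact: cg]. Qed.

Let continuousZ_ (a : R) (f : R -> R) : continuous f -> continuous (fun t : R => a * f t).
Proof. by move=> cf t; apply: cvgM; [exact: cvg_cst|exact: cf]. Qed.

Let continuous_t (b : bool) : continuous (fun t : R => if b then t else 1).
Proof. by case: b => t; [exact: cvg_id|exact: cvg_cst]. Qed.

(** Turns a symmetry identity W F = W G into the vanishing of the integral of a divergence, the
    integrands F and G differing by a multiple of it. *)
Lemma radial_int_sub0 (F G H : R -> R) (a : R) : continuous F -> continuous G ->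
  (forall t, F t - G t = a * H t) -> continuous H -> a != 0 -> W F = W G -> W H = 0.
Proof.
move=> cF cG FGH cH a0 FG; have [M YM] := sqnorm_bounded mY.
have mS := emeas_sqnorm mY.
have := radial_intD mS YM cG (@continuousZ_ a H cH); rewrite -/W.
have -> : (fun t => G t + a * H t) = F.
  by apply/funext => t; rewrite -FGH addrC subrK.
rewrite FG -[LHS]addr0 => /addrI/esym.
rewrite /W (radial_intZ mS YM _ cH) => /eqP.
by rewrite mulf_eq0 (negbTE a0) => /eqP.
Qed.

(** In the odd case s is replaced by s + 2, because differentiating 2 t P' produces an additional 2
    P'. *)
Lemma dirac_dirac_mode b P : smooth P -> dirac (dirac (mode Y b P)) =
  mode Y b (fun t => - (4 * t * D (D P) t + 2 * (s + if b then 2 else 0) * D P t)).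
Proof.
move=> sP.
have dP (u : R) := @smooth_is_derive R P 0 u sP.
have dP1 (u : R) := @smooth_is_derive R P 1 u sP.
have dP' (u : R) : derivable P u 1 by exact: sP 0 u.
case: b.
  have dB (u : R) : is_derive u 1 (fun t => - (2 * t * D P t + s * P t))
      (- (2 * u * D (D P) u + (s + 2) * D P u)).
    rewrite (_ : (fun t => _) = - ((2 \*: id) * D P + s \*: P)) //.
    by apply: is_derive_eq; rewrite /GRing.scale /= /GRing.scale /=; ring.
  rewrite (dirac_mode mY true dP') /= (dirac_mode mY false); last first.
    by move=> u; exact: (@ex_derive _ _ _ _ _ _ _ (dB u)).
  congr (mode _ _ _); apply/funext => t.
  by rewrite derive1E (@derive_val _ _ _ _ _ _ _ (dB t)); ring.
have dB (u : R) : is_derive u 1 (fun t => 2 * D P t) (2 * D (D P) u).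
  exact: (@is_deriveZ _ _ _ (D P) 2 u 1 _ (dP1 u)).
rewrite (dirac_mode mY false dP') /= (dirac_mode mY true); last first.
  by move=> u; exact: (@ex_derive _ _ _ _ _ _ _ (dB u)).
congr (mode _ _ _); apply/funext => t.
by rewrite derive1E (@derive_val _ _ _ _ _ _ _ (dB t)); ring.
Qed.

Lemma eq_chi_same_parity b l chi1 chi2 P1 P2 : 0 <= c -> 0 < W (cst 1) ->
  eigenprofile c (mode Y b) chi1 P1 -> eigenprofile c (mode Y b) chi2 P2 ->
  bandlimited c l (mode Y b P1) -> bandlimited c l (mode Y b P2) -> chi1 = chi2.
Proof.
move=> c0 W0 eP1 eP2 b1 b2; have [sP1 _ _] := eP1; have [sP2 _ _] := eP2.
pose K P (t : R) := - (4 * t * D (D P) t + 2 * (s + if b then 2 else 0) * D P t).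
have cK P : smooth P -> continuous (K P).
  move=> sP; have c1 := @smooth_continuous P 1 sP; have c2 := @smooth_continuous P 2 sP.
  rewrite (_ : K P = fun t => (-4 * t) * D (D P) t + (- 2 * (s + if b then 2 else
    0)) * D P t).
    apply: continuousD_; last exact: continuousZ_.
    apply: continuousM_; last exact: c2.
    by apply: continuousZ_ => t; exact: cvg_id.
  by apply/funext => t; rewrite /K; ring.
have mK P : smooth P -> clmeas (cball 1) (dirac (dirac (mode Y b P))).
  by move=> sP; rewrite (dirac_dirac_mode b sP); apply: (clmeas_mode mY); exact: cK.
have symc := clip_dirac2_sym c0 b1 b2 (mK _ sP1) (mK _ sP2).
have s1 := etrans (congr1 (fun f => clip f (mode Y b P2)) (dirac_dirac_mode b
  sP1)) (clip_mode Y b (K P1) P2).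
have s2 := etrans (congr1 (fun f => clip (mode Y b P1) f) (dirac_dirac_mode b
  sP2)) (clip_mode Y b P1 (K P2)).
have sym := etrans (esym s1) (etrans symc s2).
(* The Wronskian. For odd modes [G] carries the additional weight t of their scalar product. *)
pose w t := D P1 t * P2 t - P1 t * D P2 t.
pose w' t := D (D P1) t * P2 t - P1 t * D (D P2) t.
pose G t := (if b then t else 1) * w t.
have cP P n : smooth P -> continuous (derive1n n P) by exact: smooth_continuous.
have cw : continuous w.
  rewrite (_ : w = fun t => D P1 t * P2 t + (-1) * (P1 t * D P2 t)).
    apply: continuousD_; last apply: continuousZ_; apply: continuousM_.
    - exact: (cP P1 1 sP1).
    - exact: (cP P2 0 sP2).
    - exact: (cP P1 0 sP1).
    - exact: (cP P2 1 sP2).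
  by apply/funext => t; rewrite mulN1r.
have cw' : continuous w'.
  rewrite (_ : w' = fun t => D (D P1) t * P2 t + (-1) * (P1 t * D (D P2) t)).
    apply: continuousD_; last apply: continuousZ_; apply: continuousM_.
    - exact: (cP P1 2 sP1).
    - exact: (cP P2 0 sP2).
    - exact: (cP P1 0 sP1).
    - exact: (cP P2 2 sP2).
  by apply/funext => t; rewrite mulN1r.
have d1 (u : R) : is_derive u 1 P1 (D P1 u) := @smooth_is_derive R P1 0 u sP1.
have d2 (u : R) : is_derive u 1 P2 (D P2 u) := @smooth_is_derive R P2 0 u sP2.
have d11 (u : R) : is_derive u 1 (D P1) (D (D P1) u) := @smooth_is_derive R P1 1 u sP1.
have d21 (u : R) : is_derive u 1 (D P2) (D (D P2) u) := @smooth_is_derive R P2 1 u sP2.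
have dw (u : R) : is_derive u 1 w (w' u).
  have := is_deriveB (is_deriveM (d11 u) (d2 u)) (is_deriveM (d1 u) (d21 u)).
  move/is_derive_eq; apply; rewrite /GRing.scale /= /w'.
  move: (D P1 u) (D P2 u) (D (D P1) u) (D (D P2) u) (P1 u) (P2 u) => ? ? ? ? ? ?.
  by ring.
have dG (u : R) : is_derive u 1 G ((if b then 1 else 0) * w u + (if b then u else
  1) * w' u).
  rewrite /G; case: (b).
    have := is_deriveM (is_derive_id u (1 : R)) (dw u).
    by move/is_derive_eq; apply; rewrite /GRing.scale /=; ring.
  rewrite (_ : (fun t => _) = w); last by apply/funext => t; rewrite mul1r.
  by rewrite mul0r add0r mul1r.
have DG : D G = fun u => (if b then 1 else 0) * w u + (if b then u else 1) * w' u.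
  by apply/funext => u; rewrite derive1E (@derive_val _ _ _ _ _ _ _ (dG u)).
have cDG : continuous (D G).
  rewrite DG; apply: continuousD_; first exact: continuousZ_.
  exact: (continuousM_ (@continuous_t b) cw').
have cG : continuous G := continuousM_ (@continuous_t b) cw.
have dG' (u : R) : derivable G u 1 := @ex_derive _ _ _ _ _ _ _ (dG u).
have cid : continuous (fun t : R => t) by move=> t; exact: cvg_id.
have cb : continuous (fun t : R => if b then t else 1) := @continuous_t b.
have cF1 : continuous (fun t : R => (if b then t else 1) * (K P1 t * P2 t)).
  by apply: (continuousM_ cb); apply: continuousM_; [exact: cK|exact: (cP P2 0 sP2)].
have cF2 : continuous (fun t : R => (if b then t else 1) * (P1 t * K P2 t)).
  by apply: (continuousM_ cb); apply: continuousM_; [exact: (cP P1 0 sP1)|exact: cK].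
have cH : continuous (fun t : R => 2 * t * D G t + s * G t).
  exact: (continuousD_ (continuousM_ (continuousZ_ (a := 2) cid) cDG)
    (continuousZ_ (a := s) cG)).
(* Lagrange's identity: P1 P2' and P1' P2 enter through w and w' only. For odd modes the derivative
   of the weight t in [G] supplies exactly the change from s to s + 2. *)
have F12 t : (if b then t else 1) * (K P1 t * P2 t) - (if b then t else 1) * (P1
  t * K P2 t)
    = -2 * (2 * t * D G t + s * G t).
  rewrite DG /G /w /w' /K.
  move: (D P1 t) (D P2 t) (D (D P1) t) (D (D P2) t) (P1 t) (P2 t) => ? ? ? ? ? ?.
  by case: (b); ring.
have N20 : (-2 : R) != 0 by rewrite oppr_eq0 pnatr_eq0.
have G1 : G 1 = 0.
  exact: (radial_div_eq0 W0 dG' cDG (radial_int_sub0 cF1 cF2 F12 cH N20 sym)).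
have {G1} w1 : w 1 = 0 by move: G1; rewrite /G; case: (b); rewrite mul1r.
have bd chi P : eigenprofile c (mode Y b) chi P ->
    4 * D P 1 = (chi - qc - (if b then 2 * s else 0)) * P 1 /\ P 1 != 0.
  rewrite /mode; case: (b) => /= eP; first exact: odd_boundary.
  by rewrite subr0; exact: even_boundary.
have [h1 n1] := bd _ _ eP1; have [h2 n2] := bd _ _ eP2.
(* The shifts common to both boundary conditions cancel in 4 w(1), which leaves (chi1 - chi2) P1(1)
   P2(1). *)
apply/eqP; rewrite -subr_eq0; have : (chi1 - chi2) * (P1 1 * P2 1) == 0.
  have e : 4 * w 1 = (4 * D P1 1) * P2 1 - P1 1 * (4 * D P2 1) by rewrite /w; ring.
  by rewrite w1 mulr0 h1 h2 in e; apply/eqP; rewrite [RHS]e; ring.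
by rewrite mulf_eq0 mulf_eq0 (negbTE n1) (negbTE n2) !orbF.
Qed.

Lemma mixed_parity_neq l chi1 chi2 P Q : 0 <= c -> 0 < W (cst 1) ->
  eigenprofile c (mode Y false) chi1 P -> eigenprofile c (mode Y true) chi2 Q ->
  bandlimited c l (mode Y false P) -> ~ bandlimited c l (mode Y true Q).
Proof.
move=> c0 W0 eP eQ b1 b2; have [sP _ _] := eP; have [sQ _ _] := eQ.
have cP := @smooth_continuous P 0 sP; have cQ := @smooth_continuous Q 0 sQ.
have cP1 := @smooth_continuous P 1 sP; have cQ1 := @smooth_continuous Q 1 sQ.
have dP (u : R) : derivable P u 1 by exact: sP 0 u.
have dQ (u : R) : derivable Q u 1 by exact: sQ 0 u.
have d1 (u : R) : is_derive u 1 P (D P u) := @smooth_is_derive R P 0 u sP.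
have d2 (u : R) : is_derive u 1 Q (D Q u) := @smooth_is_derive R Q 0 u sQ.
pose B t := - (2 * t * D Q t + s * Q t).
have cid : continuous (fun t : R => t) by move=> t; exact: cvg_id.
have cB : continuous B.
  rewrite (_ : B = fun t => (-2 * t) * D Q t + (- s) * Q t).
    exact: (continuousD_ (continuousM_ (continuousZ_ (a := -2) cid) cQ1)
      (continuousZ_ (a := - s) cQ)).
  by apply/funext => t; rewrite /B; ring.
have e1 : dirac (mode Y false P) = mode Y true (fun t => 2 * D P t) := dirac_mode
  mY false dP.
have e2 : dirac (mode Y true Q) = mode Y false B := dirac_mode mY true dQ.
have m1 : clmeas (cball 1) (dirac (mode Y false P)).
  by rewrite e1; exact: (clmeas_mode mY true (continuousZ_ (a := 2) cP1)).
have m2 : clmeas (cball 1) (dirac (mode Y true Q)).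
  by rewrite e2; exact: (clmeas_mode mY false cB).
have := clip_dirac_sym c0 b1 b2 m1 m2; rewrite e1 e2 => symc.
have sym := etrans (esym (clip_mode Y true _ Q)) (etrans symc (clip_mode Y false P _)).
(* Pairing 2 P' x Y with x Q Y gives 2 t P' Q, and pairing P Y with D (x Q Y) gives P B; their
   difference is 2 t G' + s G. *)
pose G t := P t * Q t.
have dG (u : R) : is_derive u 1 G (D P u * Q u + P u * D Q u).
  have := is_deriveM (d1 u) (d2 u).
  by move/is_derive_eq; apply; rewrite /GRing.scale /=; ring.
have DG : D G = fun u => D P u * Q u + P u * D Q u.
  by apply/funext => u; rewrite derive1E (@derive_val _ _ _ _ _ _ _ (dG u)).
have cG : continuous G by exact: continuousM_.
have cDG : continuous (D G).
  by rewrite DG; exact: (continuousD_ (continuousM_ cP1 cQ) (continuousM_ cP cQ1)).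
have dG' (u : R) : derivable G u 1 := @ex_derive _ _ _ _ _ _ _ (dG u).
have cF1 : continuous (fun t : R => t * (2 * D P t * Q t)).
  exact: (continuousM_ cid (continuousM_ (continuousZ_ (a := 2) cP1) cQ)).
have cF2 : continuous (fun t : R => 1 * (P t * B t)).
  by apply: continuousZ_; exact: continuousM_.
have cH : continuous (fun t : R => 2 * t * D G t + s * G t).
  exact: (continuousD_ (continuousM_ (continuousZ_ (a := 2) cid) cDG)
    (continuousZ_ (a := s) cG)).
have F12 t : t * (2 * D P t * Q t) - 1 * (P t * B t) = 1 * (2 * t * D G t + s * G t).
  rewrite DG /G /B; move: (D P t) (D Q t) (P t) (Q t) => ? ? ? ?.
  by ring.
have G1 : G 1 = 0.
  exact: (radial_div_eq0 W0 dG' cDG (radial_int_sub0 cF1 cF2 F12 cH (oner_neq0 R) sym)).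
have [_ P1] := even_boundary W0 eP; have [_ Q1] := odd_boundary W0 eQ.
by move/eqP: G1; rewrite /G mulf_eq0 (negbTE P1) (negbTE Q1).
Qed.

End Distinct.

Theorem theorem6p1 (R : realType) (m k : nat) (c : R)
    (Y : 'I_(dim_monogenic m k) -> 'rV[R]_m -> clifford R m)
    (chi : nat -> R) (P Q : nat -> R -> R) (lambda : nat -> R)
    (hm : (2 <= m)%N) (hc : 0 < c)
    (hY : monogenic_onb Y)
    (hpsi : cpswf_family c Y chi P Q)
    (hlambda : forall n, 0 < lambda n)
    (heigen : forall n i x,
      trunc (bandlimit c (fun y => clcomplex (cpswf (Y i) P Q n y))) x =
      (lambda n)%:C%C *: clcomplex (cpswf (Y i) P Q n x)) :
  forall n n' : nat, n <> n' -> lambda n <> lambda n'.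
Proof.
have m0 : (0 < m)%N by exact: leq_trans hm.
(* Neither [lambda] nor [chi] depends on the basis element, so a single one suffices. *)
pose i := Ordinal (dim_monogenic_gt0 k hm).
have mY := onb_monogenic hY i.
pose p n := if odd n then Q n./2 else P n./2.
have cpE n : cpswf (Y i) P Q n = trunc (mode (Y i) (odd n) (p n)).
  by rewrite /cpswf /mode /p; case: (odd n).
have prof n : eigenprofile c (mode (Y i) (odd n)) (chi n) (p n).
  rewrite -[X in chi X]odd_double_half /mode /p; case: (odd n).
    exact: (odd_profile hpsi).
  exact: (even_profile hpsi).
have sp n : smooth (p n) by have [] := prof n.
have W0 : 0 < radial_int (sqnorm (Y i)) (cst 1).
  apply: (mode_normalised_gt0 mY (b := odd 0) (sp 0)).
  apply: etrans (cpswf_normalised hpsi i 0); apply: eq_Rintegral => t.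
  by rewrite inE => t1; rewrite cpE /trunc ifT.
have band n : bandlimited c (lambda n)^-1 (mode (Y i) (odd n) (p n)).
  apply: bandlimited_eigen => //; last by move=> x; rewrite -cpE heigen.
  by apply: (clmeas_mode mY); exact: (@smooth_continuous _ _ 0 (sp n)).
move=> n n' nn' lnn'.
(* The assumed equality of eigenvalues enters here: both functions are now [bandlimited] with the
   same factor. *)
have bn := band n; have bn' := band n'; rewrite -lnn' in bn'.
have pn := prof n; have pn' := prof n'.
have c0 : 0 <= c by exact: ltW.
have [onn'|] := eqVneq (odd n) (odd n').
  rewrite -onn' in bn' pn'.
  have chinn' := eq_chi_same_parity m0 mY c0 W0 pn pn' bn bn'.
  (* Within one parity class the order of the indices is that of their halves, along which [chi]
     increases strictly. *)
  have hlt a a' : odd a = odd a' -> (a < a')%N -> chi a < chi a'.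
    move=> oa aa'; rewrite -[X in chi X < _]odd_double_half -[X in _ < chi
      X]odd_double_half -oa.
    have haa' : (a./2 < a'./2)%N.
      move: aa'; rewrite -{1}[a]odd_double_half -{1}[a']odd_double_half -oa ltn_add2l.
      by rewrite ltn_double.
    by case: (odd a); [exact: (odd_increasing hpsi)|exact: (even_increasing hpsi)].
  by case: (ltngtP n n') nn' => // h _; have := hlt _ _ _ h;
    rewrite chinn' onn' ltxx => /(_ erefl).
case on: (odd n) in bn pn *; case on': (odd n') in bn' pn' * => // _.
- exact: (mixed_parity_neq m0 mY c0 W0 pn' pn bn').
- exact: (mixed_parity_neq m0 mY c0 W0 pn pn' bn).
Qed.
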